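(* Let $X$ be a locally convex space and let a net of logarithmically concave measures $\mu_\alpha$ on $X$ converge weakly to a Radon measure $\mu$. Then $\mu_\alpha\to\mu$ in the topology $\tau_{K,q}$ for every $q\ge1$.
   Context: Locally convex spaces are real and Hausdorff. A finite nonnegative Borel measure $\mu$ is Radon if for every Borel set $B$ and $\varepsilon>0$ there is a compact $K\subset B$ with $\mu(B\setminus K)<\varepsilon$; a signed Borel measure is Radon if its total variation $|\mu|$ is. A Radon probability measure $\mu$ on $X$ is logarithmically concave if $\mu(tA+(1-t)B)\ge\mu(A)^t\mu(B)^{1-t}$ for all compact sets $A,B$ and all $t\in(0,1)$. Weak convergence means convergence of the integrals of every bounded continuous function. Let $\Pi$ be the collection of pseudometrics $p(x-y)$ with $p$ a continuous seminorm on $X$. $\mathcal{M}_r^q(X)$ is the space of (signed) Radon measures $\mu$ on $X$ such that $p^q$ is $|\mu|$-integrable for every continuous seminorm $p$. For a continuous seminorm $p$ let $$\|\mu\|_{KR,p}=\sup\Bigl\{\int_X f\,d\mu\colon |f(x)-f(y)|\le p(x-y)\ \forall x,y\in X,\ |f|\le1\Bigr\}.$$ The topology $\tau_{K,q}$ on $\mathcal{M}_r^q(X)$ is generated by the seminorms $K_{p,q}(\mu)=\|(1+p(\cdot-x_0)^q)\cdot\mu\|_{KR,p}$, where $p$ ranges over all continuous seminorms, $x_0\in X$ is a fixed point (e.g. $x_0=0$), and $g\cdot\mu$ is the measure with density $g$ with respect to $\mu$. *)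

(* Defs.v *)
From HB Require Import structures.
From mathcomp Require Import all_boot all_order all_algebra.
From mathcomp Require Import all_classical all_reals all_analysis.

Set Implicit Arguments.
Unset Strict Implicit.
Unset Printing Implicit Defensive.

Import Order.TTheory GRing.Theory Num.Theory.
Import numFieldNormedType.Exports.

Local Open Scope classical_set_scope.
Local Open Scope ring_scope.

Section signed_measures.
Context d (T : measurableType d) (R : realType).
Implicit Types (nu : {charge set T -> \bar R}) (g : T -> R).

Lemma hahnP nu : {PN : set T * set T | hahn_decomposition nu PN.1 PN.2}.
Proof.
by apply: cid; have [P [N PN]] := Hahn_decomposition nu; exists (P, N).
Qed.

(* The three measures below do not depend, on measurable sets, on the chosen
   Hahn decomposition (Hahn_decomposition_uniq). *)
Definition pos_part nu : {finite_measure set T -> \bar R} :=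
  jordan_pos (projT2 (hahnP nu)).

Definition neg_part nu : {finite_measure set T -> \bar R} :=
  jordan_neg (projT2 (hahnP nu)).

Definition total_variation nu : {measure set T -> \bar R} :=
  charge_variation (projT2 (hahnP nu)).

Definition charge_integral nu g : R :=
  \int[pos_part nu]_x g x - \int[neg_part nu]_x g x.

Definition csub (nu1 nu2 : {charge set T -> \bar R}) :
    {charge set T -> \bar R} :=
  cadd nu1 (copp nu2).

(* The charge g . nu with density g with respect to nu; the value is the zero
   charge when g is not |nu|-integrable. *)
Definition charge_density g nu : {charge set T -> \bar R} :=
  match pselect ((pos_part nu).-integrable [set: T] (EFin \o g)),
        pselect ((neg_part nu).-integrable [set: T] (EFin \o g)) with
  | left gp, left gn => csub (induced_charge gp) (induced_charge gn)
  | _, _ => czero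
  end.

End signed_measures.

(* X is viewed through its zmodType structure, from which the library derives
   the pointed structure that generated sigma-algebras require. *)
Definition borel (R : realType) (X : tvsType R) :=
  @g_sigma_algebraType (X : zmodType) (@open X).

Section locally_convex.
Context (R : realType) (X : tvsType R).

Definition radon (mu : {measure set (borel X) -> \bar R}) : Prop :=
  forall B : set X, measurable (B : set (borel X)) ->
    forall e : R, 0 < e ->
      exists2 K : set X, compact K /\ K `<=` B & (mu (B `\` K) < e%:E)%E.

Definition signed_radon (nu : {charge set (borel X) -> \bar R}) : Prop :=
  radon (total_variation nu).

Definition convex_comb (t : R) (A B : set X) : set X :=
  [set t *: a + (1 - t) *: b | a in A & b in B].

Definition log_concave (mu : probability (borel X) R) : Prop :=
  radon mu /\
  forall (A B : set X) (t : R), compact A -> compact B -> 0 < t < 1 ->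
    (mu A `^ t * mu B `^ (1 - t) <= mu (convex_comb t A B))%E.

Definition continuous_seminorm (p : X -> R) : Prop :=
  [/\ forall x, 0 <= p x,
      forall x y, p (x + y) <= p x + p y,
      forall (a : R) x, p (a *: x) = `|a| * p x
    & continuous p].

Definition finite_moments (q : R) (nu : {charge set (borel X) -> \bar R}) :
    Prop :=
  forall p, continuous_seminorm p ->
    (total_variation nu).-integrable [set: borel X]
      (fun x => ((p x) `^ q)%:E).

Record Mrq (q : R) := MkMrq {
  Mrq_charge :> {charge set (borel X) -> \bar R} ;
  Mrq_radon : signed_radon Mrq_charge ;
  Mrq_moments : finite_moments q Mrq_charge }.

Definition KR_norm (p : X -> R) (nu : {charge set (borel X) -> \bar R}) : R :=
  sup [set charge_integral nu f | f in
    [set f : X -> R | (forall x y, `|f x - f y| <= p (x - y)) /\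
                      (forall x, `|f x| <= 1)]].

Definition K_seminorm (q : R) (x0 : X) (p : X -> R)
    (nu : {charge set (borel X) -> \bar R}) : R :=
  KR_norm p (charge_density (fun x : borel X => 1 + (p (x - x0)) `^ q) nu).

(* The space of the measures in Mrq q with the topology generated by the
   seminorms K_seminorm q x0 p: open balls of these seminorms, with arbitrary
   centres, form a subbase. *)
Definition tauK (q : R) (x0 : X) : Type := Mrq q.

HB.instance Definition _ q x0 := gen_eqMixin (tauK q x0).
HB.instance Definition _ q x0 := gen_choiceMixin (tauK q x0).

Definition tauK_subbase (q : R) (x0 : X) : set (set (tauK q x0)) :=
  [set U | exists (p : X -> R) (nu : Mrq q) (e : R),
    [/\ continuous_seminorm p, 0 < e &
        U = [set m : Mrq q | K_seminorm q x0 p (csub m nu) < e]]].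

HB.instance Definition _ (q : R) (x0 : X) :=
  isSubBaseTopological.Build (tauK q x0) (tauK_subbase (x0 := x0)) id.

Definition weak_cvg (I : Type) (F : set_system I)
    (nu_ : I -> {charge set (borel X) -> \bar R})
    (nu : {charge set (borel X) -> \bar R}) : Prop :=
  forall f : X -> R, continuous f -> (exists M, forall x, `|f x| <= M) ->
    charge_integral (nu_ i) f @[i --> F] --> charge_integral nu f.

End locally_convex.

Definition directed_preorder (I : Type) (le : I -> I -> Prop) : Prop :=
  [/\ inhabited I,
      forall i, le i i,
      forall i j k, le i j -> le j k -> le i k
    & forall i j, exists k, le i k /\ le j k].

(* The filter of tails of a directed set; convergence of a net along it is the
   usual net convergence. *)
Definition tails (I : Type) (le : I -> I -> Prop) : set_system I :=
  [set S | exists i0, forall i, le i0 i -> S i].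

(* Main.v *)
Require Import Defs.
From HB Require Import structures.
From mathcomp Require Import all_boot all_order all_algebra.
From mathcomp Require Import finmap all_classical all_reals all_analysis.
From mathcomp Require Import measurable_realfun ring lra.

(* Testing against continuous functions that separate disjoint compact sets
   shows that the limit is nonnegative.  For a logarithmically concave measure
   and phi = p(. - c), the midpoint case of the inequality (Borell) reads
     mu{phi > 3u} mu{phi <= u} <= mu{phi > u}^2,
   so that once mu{phi > r} is small, the tails mu{phi > 3^n r} decay
   geometrically with a ratio as small as desired, and every moment of phi is
   bounded in terms of r only.  Weak convergence provides one r that works
   eventually along the net; hence the weight g = 1 + p(. - x0)^q has eventually
   bounded second moments, and int u g dmu_i -> int u g dmu for every bounded
   continuous u, by truncating g.  Finally, convergence is uniform over the
   functions f with |f| <= 1 that are 1-Lipschitz for p: on a compact set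
   carrying most of mu, such an f is uniformly close to combinations, with
   coefficients in [-1, 1], of finitely many functions of a partition of unity
   subordinate to small p-balls. *)

Set Implicit Arguments.
Unset Strict Implicit.
Unset Printing Implicit Defensive.

Import Order.TTheory GRing.Theory Num.Theory.
Import numFieldNormedType.Exports.

Local Open Scope classical_set_scope.
Local Open Scope ring_scope.

(** * Topological preliminaries *)

Lemma tails_proper_filter (I : Type) (le : I -> I -> Prop) :
  directed_preorder le -> ProperFilter (tails le).
Proof.
move=> [[i0] le_refl le_trans le_dir]; split.
  by move=> [i /(_ i (le_refl i))].
split; first by exists i0.
  move=> P Q [i iP] [j jQ]; have [k [ik jk]] := le_dir i j.
  by exists k => l kl; split; [exact/iP/le_trans/kl|exact/jQ/le_trans/kl].
by move=> P Q PQ [i iP]; exists i => j /iP /PQ.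
Qed.

(** Supplies Urysohn functions for a compact set although the space need not be normal. Around each
    point of [K], half of an entourage missing [L] serves all nearby points; compactness in its
    near-covering form then gives one entourage for the whole of [K]. *)
Lemma compact_closed_separator (X : uniformType) (K L : set X) :
  compact K -> closed L -> K `&` L = set0 -> uniform_separator K L.
Proof.
move=> /compact_near_coveringP cK cL KL0; apply: uniform_separatorW.
(* Properness of the entourage filter uses a point of the space, so empty [K] is treated apart. *)
have [K0|/set0P[x0 _]] := eqVneq K set0.
  by exists setT; [exact: filterT|rewrite K0 set0X set0I].
have entF : ProperFilter (@entourage X).
  by split=> [e0|]; [exact: (entourage_refl x0 e0)|exact: entourage_filter].
have : \forall E \near powerset_filter_from (@entourage X),
    K `<=` (fun y => forall z, E (y, z) -> ~ L z).
  apply: cK => x Kx.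
  have [E entE EnL] : exists2 E, entourage E & xsection E x `<=` ~` L.
    have : nbhs x (~` L).
      apply: open_nbhs_nbhs; split; first exact: closed_openC.
      by move=> Lx; have : (K `&` L) x by []; rewrite KL0.
    by rewrite -nbhs_entourageE => -[E entE EL]; exists E.
  have sE := entourage_split_ent entE.
  near=> y E' => z E'yz Lz.
  suff /EnL : xsection E x z by [].
  apply/xsectionP; apply: (@entourage_split _ y) => //.
    by apply/xsectionP; near: y; exact: nbhs_entourage.
  by apply: (near (small_set_sub sE) E').
case/near_powerset_filter_fromP; first by move=> A B AB h x /h {}h z /AB /h.
move=> E entE EKL; exists E => //; rewrite -subset0 => -[y z] [[/= Ky Lz] Eyz].
exact: (EKL y Ky z).
Unshelve. all: by end_near. Qed.

Section borel_space.
Context (R : realType) (X : tvsType R).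

Lemma open_borel_measurable (U : set X) : open U ->
  measurable (U : set (borel X)).
Proof. by move=> oU; exact: sub_sigma_algebra. Qed.

Lemma closed_borel_measurable (U : set X) : closed U ->
  measurable (U : set (borel X)).
Proof.
move=> cU; rewrite -(setCK U); apply: measurableC.
by apply: open_borel_measurable; apply: closed_openC.
Qed.

Lemma continuous_borel_measurable (f : X -> R) : continuous f ->
  measurable_fun [set: borel X] (f : borel X -> R).
Proof.
move=> cf.
apply: (measurability _ (measurable_realfun.RGenOpens.measurableE R)).
move=> _ [_ [a [b ->] <-]]; rewrite setTI.
by apply: open_borel_measurable; apply: open_comp => // x _; exact: cf.
Qed.

Lemma lt_preimage_measurable (f : X -> R) (u : R) : continuous f ->
  measurable ([set x | u < f x] : set (borel X)).
Proof.
move=> cf; apply: open_borel_measurable.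
by apply: (@open_comp _ _ f [set y | u < y]) => // x _; exact: cf.
Qed.

Lemma le_preimage_measurable (f : X -> R) (u : R) : continuous f ->
  measurable ([set x | f x <= u] : set (borel X)).
Proof.
move=> cf; apply: closed_borel_measurable.
by apply: (@closed_comp _ _ f [set y | y <= u]) => // x _; exact: cf.
Qed.

End borel_space.

(** * Integration against charges *)

Lemma fin_num_eq_subD (R : realDomainType) (x y z t : \bar R) :
  x \is a fin_num -> y \is a fin_num -> z \is a fin_num -> t \is a fin_num ->
  (x - y = z - t -> x + t = z + y)%E.
Proof.
move=> /fineK <- /fineK <- /fineK <- /fineK <-.
by rewrite -!EFinB -!EFinD => -[] h; congr EFin; lra.
Qed.

Lemma fin_num_sub_subE (R : realDomainType) (x y z t : \bar R) :
  x \is a fin_num -> y \is a fin_num -> z \is a fin_num -> t \is a fin_num ->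
  (x - y + - (z - t) = (x + t) - (y + z))%E.
Proof.
move=> /fineK <- /fineK <- /fineK <- /fineK <-.
by rewrite -!EFinB; congr EFin; ring.
Qed.

Section finite_measures.
Context d (T : measurableType d) (R : realType).
Implicit Types (f g : T -> R) (nu : {charge set T -> \bar R}).

Lemma bounded_integrable (m : {finite_measure set T -> \bar R}) f (M : R) :
  measurable_fun setT f -> (forall x, `|f x| <= M) ->
  m.-integrable setT (EFin \o f).
Proof.
move=> mf fM; apply: measurable_bounded_integrable => //.
  by rewrite -ge0_fin_numE// fin_num_measure.
exists M; split; first exact: num_real.
by move=> y My x _; exact/(le_trans (fM x))/ltW.
Qed.

Lemma dominated_integrable (m : {measure set T -> \bar R}) f g :
  measurable_fun setT f -> (forall x, `|f x| <= g x) ->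
  m.-integrable setT (EFin \o g) -> m.-integrable setT (EFin \o f).
Proof.
move=> mf fg; apply: le_integrable => //; first exact/measurable_EFinP.
by move=> x _; rewrite lee_fin (le_trans (fg x))// ler_norm.
Qed.

Lemma le_measure_integrable (m1 m2 : {measure set T -> \bar R})
    (f : T -> \bar R) :
  (forall A, measurable A -> (m1 A <= m2 A)%E) ->
  m2.-integrable setT f -> m1.-integrable setT f.
Proof.
move=> m12 /integrableP[mf foo]; apply/integrableP; split => //.
apply: le_lt_trans foo; apply: ge0_le_measure_integral => //.
exact: measurableT_comp.
Qed.

Lemma EFin_integrableD (m : {measure set T -> \bar R}) f g :
  m.-integrable setT (EFin \o f) -> m.-integrable setT (EFin \o g) ->
  m.-integrable setT (EFin \o (fun x => f x + g x)).
Proof. by move=> mf mg; have h := integrableD measurableT mf mg; exact: h. Qed.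

Lemma EFin_integrableB (m : {measure set T -> \bar R}) f g :
  m.-integrable setT (EFin \o f) -> m.-integrable setT (EFin \o g) ->
  m.-integrable setT (EFin \o (fun x => f x - g x)).
Proof. by move=> mf mg; have h := integrableB measurableT mf mg; exact: h. Qed.

Lemma EFin_integrableZl (m : {measure set T -> \bar R}) (c : R) f :
  m.-integrable setT (EFin \o f) ->
  m.-integrable setT (EFin \o (fun x => c * f x)).
Proof. by move=> mf; have h := integrableZl measurableT c mf; exact: h. Qed.

Lemma pos_partE nu A : measurable A ->
  pos_part nu A = nu (A `&` (sval (hahnP nu)).1).
Proof.
by move=> mA; rewrite [LHS]jordan_posE cjordan_posE /crestr0 mem_set.
Qed.

Lemma neg_partE nu A : measurable A ->
  neg_part nu A = (- nu (A `&` (sval (hahnP nu)).2))%E.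
Proof.
by move=> mA; rewrite [LHS]jordan_negE cjordan_negE /crestr0 mem_set.
Qed.

Lemma measurable_hahn1 nu : measurable (sval (hahnP nu)).1.
Proof. by case: (svalP (hahnP nu)) => -[]. Qed.

Lemma measurable_hahn2 nu : measurable (sval (hahnP nu)).2.
Proof. by case: (svalP (hahnP nu)) => _ []. Qed.

Lemma pos_neg_part nu A : measurable A ->
  nu A = (pos_part nu A - neg_part nu A)%E.
Proof.
by move=> mA; rewrite (jordan_decomp (svalP (hahnP nu)) mA) /cadd/= cscaleN1.
Qed.

Section difference_of_measures.
Variables (nu : {charge set T -> \bar R}) (a b : {measure set T -> \bar R}).
Hypotheses (a_fin : fin_num_fun a) (b_fin : fin_num_fun b).
Hypothesis nuE : forall A, measurable A -> nu A = (a A - b A)%E.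

(** Minimality of the Jordan decomposition: the positive part is [nu] restricted to the positive
    Hahn set, and dropping first [b] and then the restriction only enlarges the value. *)
Lemma pos_part_le A : measurable A -> (pos_part nu A <= a A)%E.
Proof.
move=> mA; have mP := measurable_hahn1 nu.
have mAP : measurable (A `&` (sval (hahnP nu)).1) by exact: measurableI.
rewrite pos_partE// nuE// (@le_trans _ _ (a (A `&` (sval (hahnP nu)).1)))//.
  by rewrite leeBlDr ?b_fin// leeDl.
by apply: le_measure; rewrite ?inE.
Qed.

Lemma neg_part_le A : measurable A -> (neg_part nu A <= b A)%E.
Proof.
move=> mA; have mP := measurable_hahn2 nu.
have mAP : measurable (A `&` (sval (hahnP nu)).2) by exact: measurableI.
rewrite neg_partE// nuE// (@le_trans _ _ (b (A `&` (sval (hahnP nu)).2)))//.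
  by rewrite fin_num_oppeB ?b_fin// addeC leeBlDr ?a_fin// leeDl.
by apply: le_measure; rewrite ?inE.
Qed.

(** The positive part of [nu] plus [b] equals [a] plus the negative part, as measures. Integrating
    this identity and rearranging is legitimate because all four integrals are finite. *)
Lemma charge_integral_diff f :
  a.-integrable setT (EFin \o f) -> b.-integrable setT (EFin \o f) ->
  charge_integral nu f = \int[a]_x f x - \int[b]_x f x.
Proof.
move=> af bf.
have pf : (pos_part nu).-integrable setT (EFin \o f).
  by apply: le_measure_integrable af => A; exact: pos_part_le.
have nf : (neg_part nu).-integrable setT (EFin \o f).
  by apply: le_measure_integrable bf => A; exact: neg_part_le.
have : (\int[measure_add (pos_part nu) b]_x (f x)%:E =
        \int[measure_add a (neg_part nu)]_x (f x)%:E)%E.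
  apply: eq_measure_integral => A mA _.
  rewrite [LHS]measure_addE [RHS]measure_addE.
  apply: fin_num_eq_subD.
  - exact: (fin_num_measure (pos_part nu)).
  - exact: (fin_num_measure (neg_part nu)).
  - exact: a_fin.
  - exact: b_fin.
  - by rewrite -nuE//; exact/esym/pos_neg_part.
rewrite !integral_measure_add//.
move: (integrable_fin_num measurableT af) (integrable_fin_num measurableT bf)
  (integrable_fin_num measurableT pf) (integrable_fin_num measurableT nf).
rewrite /charge_integral /Rintegral.
move=> /fineK <- /fineK <- /fineK <- /fineK <-.
by rewrite -!EFinD/= => -[] h; lra.
Qed.

End difference_of_measures.

Lemma charge_integral_measure nu (m : {finite_measure set T -> \bar R}) f :
  (forall A, measurable A -> nu A = m A) -> m.-integrable setT (EFin \o f) ->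
  charge_integral nu f = \int[m]_x f x.
Proof.
move=> nuE mf; rewrite (@charge_integral_diff _ m mzero)//.
- by rewrite /Rintegral integral_measure_zero subr0.
- by move=> A mA; rewrite nuE// sube0.
- apply/integrableP; split; first by case/integrableP: mf.
  by rewrite integral_measure_zero.
Qed.

Lemma measure_add_integrable (m1 m2 : {measure set T -> \bar R})
    (f : T -> \bar R) : m1.-integrable setT f -> m2.-integrable setT f ->
  (measure_add m1 m2).-integrable setT f.
Proof.
move=> /integrableP[mf m1f] /integrableP[_ m2f]; apply/integrableP.
split=> //; rewrite ge0_integral_measure_add//; first exact: lte_add_pinfty.
exact: measurableT_comp.
Qed.

Lemma integrable_pos_part nu (f : T -> \bar R) :
  (Defs.total_variation nu).-integrable setT f ->
  (pos_part nu).-integrable setT f.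
Proof. by apply: le_measure_integrable => A _; exact: leeDl. Qed.

Lemma integrable_neg_part nu (f : T -> \bar R) :
  (Defs.total_variation nu).-integrable setT f ->
  (neg_part nu).-integrable setT f.
Proof. by apply: le_measure_integrable => A _; exact: leeDr. Qed.

Lemma integrable_total_variation nu (f : T -> \bar R) :
  (pos_part nu).-integrable setT f -> (neg_part nu).-integrable setT f ->
  (Defs.total_variation nu).-integrable setT f.
Proof.
move=> pf nf; apply: le_measure_integrable (measure_add_integrable pf nf).
by move=> A _; rewrite le_eqVlt; apply/orP; left; apply/eqP/esym/measure_addE.
Qed.

(** In general this is not the Jordan decomposition of the difference, but any writing as a
    difference of two finite measures feeds [charge_integral_diff] and the minimality bounds. *)
Lemma csubE (nu1 nu2 : {charge set T -> \bar R}) (A : set T) : measurable A ->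
  csub nu1 nu2 A = (measure_add (pos_part nu1) (neg_part nu2) A -
                    measure_add (neg_part nu1) (pos_part nu2) A)%E.
Proof.
move=> mA.
transitivity (pos_part nu1 A - neg_part nu1 A +
              - (pos_part nu2 A - neg_part nu2 A))%E.
  by rewrite -!pos_neg_part.
rewrite fin_num_sub_subE ?fin_num_measure//.
by congr (_ - _)%E; exact/esym/measure_addE.
Qed.

Lemma measure_add_fin (m1 m2 : {finite_measure set T -> \bar R}) :
  fin_num_fun (measure_add m1 m2).
Proof.
move=> A mA; rewrite [X in X \is a _]measure_addE fin_numD.
by rewrite (fin_num_measure m1)// (fin_num_measure m2).
Qed.

Lemma csub_integrable (nu1 nu2 : {charge set T -> \bar R}) f :
  (Defs.total_variation nu1).-integrable setT (EFin \o f) ->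
  (Defs.total_variation nu2).-integrable setT (EFin \o f) ->
  (Defs.total_variation (csub nu1 nu2)).-integrable setT (EFin \o f).
Proof.
move=> f1 f2; apply: integrable_total_variation.
- apply: le_measure_integrable
    (measure_add_integrable (integrable_pos_part f1) (integrable_neg_part f2)).
  by move=> A; apply: (pos_part_le (@measure_add_fin _ _) (@csubE nu1 nu2)).
- apply: le_measure_integrable
    (measure_add_integrable (integrable_neg_part f1) (integrable_pos_part f2)).
  move=> A; apply: (neg_part_le _ _ (@csubE nu1 nu2)); exact: measure_add_fin.
Qed.

Lemma charge_integral_csub (nu1 nu2 : {charge set T -> \bar R}) f :
  (Defs.total_variation nu1).-integrable setT (EFin \o f) ->
  (Defs.total_variation nu2).-integrable setT (EFin \o f) ->
  charge_integral (csub nu1 nu2) f =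
    charge_integral nu1 f - charge_integral nu2 f.
Proof.
move=> f1 f2; have p1 := integrable_pos_part f1.
have n1 := integrable_neg_part f1; have p2 := integrable_pos_part f2.
have n2 := integrable_neg_part f2.
rewrite (charge_integral_diff (@measure_add_fin _ _) (@measure_add_fin _ _)
  (@csubE nu1 nu2)); 
  [|exact: measure_add_integrable|exact: measure_add_integrable].
rewrite /charge_integral /Rintegral !integral_measure_add//.
move: (integrable_fin_num measurableT p1) (integrable_fin_num measurableT p2)
  (integrable_fin_num measurableT n1) (integrable_fin_num measurableT n2).
move=> /fineK <- /fineK <- /fineK <- /fineK <-.
by rewrite -!EFinD/=; lra.
Qed.

Lemma le_total_variation nu (m : {finite_measure set T -> \bar R}) A :
  (forall B, measurable B -> nu B = m B) -> measurable A ->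
  (Defs.total_variation nu A <= m A)%E.
Proof.
move=> nuE mA.
have nuE0 B : measurable B -> nu B = (m B - mzero B)%E.
  by move=> mB; rewrite nuE// sube0.
have mfin : fin_num_fun m by move=> B mB; exact: fin_num_measure.
have zfin : fin_num_fun (mzero : {measure set T -> \bar R}) by [].
have -> : Defs.total_variation nu A = (pos_part nu A + neg_part nu A)%E by [].
rewrite -[leRHS]adde0; apply: leeD; first exact: (pos_part_le zfin nuE0).
exact: (neg_part_le mfin zfin nuE0).
Qed.

Lemma le_charge_integral nu f g :
  (Defs.total_variation nu).-integrable setT (EFin \o g) ->
  measurable_fun setT f -> (forall x, `|f x| <= g x) ->
  `|charge_integral nu f| <=
    \int[pos_part nu]_x g x + \int[neg_part nu]_x g x.
Proof.
move=> nug mf fg; rewrite /charge_integral (le_trans (ler_normB _ _))//.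
have le1 (m : {finite_measure set T -> \bar R}) :
    m.-integrable setT (EFin \o g) -> `|\int[m]_x f x| <= \int[m]_x g x.
  move=> mg; have mif := dominated_integrable mf fg mg.
  apply: le_trans (le_normr_Rintegral measurableT mif) _.
  apply: le_Rintegral => //.
  by have := integrable_abse mif; apply: eq_integrable.
apply: lerD; apply: le1; first exact: integrable_pos_part.
exact: integrable_neg_part.
Qed.

End finite_measures.

(** * Measures given by a density *)

Section density.
Context d (T : measurableType d) (R : realType).
Variables (m : {finite_measure set T -> \bar R}) (g : T -> R).
Hypothesis mg : m.-integrable setT (EFin \o g).
Hypothesis g_ge0 : forall x, 0 <= g x.

Let induced_ge0 A : (0 <= induced_charge mg A)%E.
Proof. by apply: integral_ge0 => x _; rewrite lee_fin. Qed.

(** The induced charge repackaged as a measure, so that it agrees by computation with the charges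
    inside [charge_density]. *)
Definition weighted_measure :=
  measure_of_charge (induced_charge mg) induced_ge0.

HB.instance Definition _ := Measure.on weighted_measure.

Let weighted_fin : fin_num_fun weighted_measure.
Proof. by move=> A mA; exact: (@fin_num_measure _ _ _ (induced_charge mg)). Qed.

HB.instance Definition _ := @Measure_isFinite.Build _ _ _ weighted_measure
  weighted_fin.

(** Change of variables through the Radon-Nikodym derivative, which equals [g] almost everywhere
    because both have the same integral over every measurable set. *)
Lemma integral_weighted_measure f :
  weighted_measure.-integrable setT (EFin \o f) ->
  \int[weighted_measure]_x f x = \int[m]_x (f x * g x).
Proof.
move=> wf.
have wm : weighted_measure `<< m.
  apply/null_content_dominatesP => A mA mA0.
  apply: null_set_integral => //.
  by apply: measurable_funTS; exact: measurable_int mg.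
rewrite /Rintegral -(Radon_Nikodym_change_of_variables wm)//; congr fine.
have mf : measurable_fun setT (EFin \o f) by exact: measurable_int wf.
apply: ae_eq_integral => //.
- exact: emeasurable_funM.
- apply/measurable_EFinP; apply: measurable_funM; first exact/measurable_EFinP.
  by apply/measurable_EFinP; exact: measurable_int mg.
- under [X in ae_eq _ _ _ X]eq_fun do rewrite EFinM.
  apply: ae_eqe_mul2l; apply: integral_ae_eq => //.
  + by apply: Radon_Nikodym_integrable.
  + exact: measurable_int mg.
  + by move=> A _ mA; rewrite -Radon_Nikodym_integral.
Qed.

End density.

(** Integrability of [g] excludes the default zero charge. The weighted Jordan parts of [nu] then
    exhibit the density charge as a difference of finite measures, against both of which the bounded
    [f] is integrable. *)
Lemma charge_integral_density d (T : measurableType d) (R : realType)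
    (nu : {charge set T -> \bar R}) (g f : T -> R) (M : R) :
  (Defs.total_variation nu).-integrable setT (EFin \o g) ->
  (forall x, 0 <= g x) ->
  measurable_fun setT f -> (forall x, `|f x| <= M) ->
  charge_integral (charge_density g nu) f =
    charge_integral nu (fun x => f x * g x).
Proof.
move=> nug g0 mf fM.
rewrite /charge_density; case: pselect => [gp|]; last first.
  by move=> /(_ (integrable_pos_part nug)).
case: pselect => [gn|]; last by move=> /(_ (integrable_neg_part nug)).
rewrite (@charge_integral_diff _ _ _ _ (weighted_measure gp g0)
  (weighted_measure gn g0)).
- rewrite /charge_integral !integral_weighted_measure//;
    exact: bounded_integrable fM.
- exact: fin_num_measure.
- exact: fin_num_measure.
- by [].
- exact: bounded_integrable fM.
- exact: bounded_integrable fM.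
Qed.

(** * Nonnegativity of weak limits *)

Lemma Rintegral_indic d (T : measurableType d) (R : realType)
    (m : {measure set T -> \bar R}) (A : set T) : measurable A ->
  \int[m]_x \1_A x = fine (m A).
Proof. by move=> mA; rewrite /Rintegral integral_indic// setIT. Qed.

Section positivity.
Context (R : realType) (X : tvsType R).

(** Compact sets [L] and [K] carry the positive and negative parts up to [e], and are disjoint since
    they lie in the two Hahn sets. A continuous [f] with values in [0, 1], equal to 0 on [L] and to
    1 on [K], has integral at most [e] minus the negative mass of [K]; as this integral is
    nonnegative, the whole negative mass is at most [e + e]. *)
Lemma signed_radon_neg_part0 (nu : {charge set (borel X) -> \bar R}) :
  hausdorff_space X -> signed_radon nu ->
  (forall f : X -> R, continuous f -> (forall x, 0 <= f x <= 1) ->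
    0 <= charge_integral nu f) ->
  neg_part nu setT = 0%E.
Proof.
move=> hX nu_radon nu_ge0.
have [_ _ PNT PN0] := svalP (hahnP nu).
have mP := measurable_hahn1 nu; have mN := measurable_hahn2 nu.
set P : set X := (sval (hahnP nu)).1 in PNT PN0 mP.
set N : set X := (sval (hahnP nu)).2 in PNT PN0 mN.
suff small e : 0 < e -> fine (neg_part nu setT) <= e + e.
  rewrite -(fineK (fin_num_measure (neg_part nu) _ measurableT)); congr EFin.
  apply/eqP; rewrite eq_le fine_ge0// andbT; apply/ler_addgt0Pr => e e0.
  by rewrite add0r (splitr e); apply: small; rewrite divr_gt0.
move=> e0.
have [L [cL LP] PL] := nu_radon _ mP _ e0.
have [K [cK KN] NK] := nu_radon _ mN _ e0.
have mL : measurable (L : set (borel X)).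
  by apply: closed_borel_measurable; exact: compact_closed.
have mK : measurable (K : set (borel X)).
  by apply: closed_borel_measurable; exact: compact_closed.
have mLc : measurable (~` L : set (borel X)) by exact: measurableC.
have mKc : measurable (~` K : set (borel X)) by exact: measurableC.
(* The positive part lives on [P], so it gives the complement of [L] the mass of [P] minus [L]. *)
have posL : fine (pos_part nu (~` L)) <= e.
  rewrite -lee_fin fineK ?fin_num_measure//.
  suff -> : pos_part nu (~` L) = pos_part nu (P `\` L).
    by rewrite (le_trans _ (ltW PL))// leeDl.
  rewrite !pos_partE//; last exact: measurableD.
  by congr (nu _); rewrite setDE -setIA setIC setIA setIid setIC.
have negK : fine (neg_part nu (~` K)) <= e.
  rewrite -lee_fin fineK ?fin_num_measure//.
  suff -> : neg_part nu (~` K) = neg_part nu (N `\` K).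
    by rewrite (le_trans _ (ltW NK))// leeDr.
  rewrite !neg_partE//; last exact: measurableD.
  by congr (- nu _)%E; rewrite setDE -setIA setIC setIA setIid setIC.
have LK0 : L `&` K = set0.
  by rewrite -subset0 => x [/LP Px /KN Nx]; rewrite -PN0.
have [f [cf f01 fL fK]] := (@uniform_separatorP _ R _ _).1
  (compact_closed_separator cL (compact_closed hX cK) LK0).
have f_01 x : 0 <= f x <= 1.
  by have := f01 (f x); rewrite /= in_itv/=; apply; exists x.
have f_norm x : `|f x| <= 1 by have /andP[? ?] := f_01 x; rewrite ger0_norm.
have mf := continuous_borel_measurable cf.
have indic_int (m : {finite_measure set (borel X) -> \bar R})
    (A : set (borel X)) :
    measurable A -> m.-integrable setT (EFin \o \1_A).
  by move=> mA; exact: integrable_indic.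
have Ipos : \int[pos_part nu]_x f x <= e.
  apply: le_trans posL; rewrite -Rintegral_indic//.
  apply: le_Rintegral => //.
  - exact: (@bounded_integrable _ _ _ (pos_part nu) _ _ mf f_norm).
  - exact: (indic_int (pos_part nu)).
  move=> x _; rewrite indicE; case: (boolP (x \in _)) => [_|].
    by have /andP[] := f_01 x.
  by rewrite notin_setE/= => /contrapT Lx; rewrite (fL (f x))//; exists x.
have Ineg : fine (neg_part nu K) <= \int[neg_part nu]_x f x.
  rewrite -Rintegral_indic//.
  apply: le_Rintegral => //.
  - exact: (indic_int (neg_part nu)).
  - exact: (@bounded_integrable _ _ _ (neg_part nu) _ _ mf f_norm).
  move=> x _; rewrite indicE; case: (boolP (x \in _)) => [|_].
    by rewrite inE => Kx; rewrite (fK (f x))//; exists x.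
  by have /andP[] := f_01 x.
have negT : fine (neg_part nu setT) =
    fine (neg_part nu K) + fine (neg_part nu (~` K)).
  rewrite -fineD ?fin_num_measure//; congr fine.
  by rewrite -(setUv K) measureU// setICr.
have := nu_ge0 f cf f_01; rewrite /charge_integral.
by move: Ipos Ineg negT negK; lra.
Qed.

End positivity.

(** * Tails and moments of logarithmically concave measures *)

Section log_concave.
Context (R : realType) (X : tvsType R).
Hypothesis X_hausdorff : hausdorff_space X.
Implicit Types (mu : probability (borel X) R) (p : X -> R).

Lemma seminorm_sub_continuous p (c : X) : continuous_seminorm p ->
  continuous (fun x => p (x - c)).
Proof.
move=> [_ _ _ cp] x; apply: (@continuous_comp _ _ _ (fun x => x - c)).
  apply: (@continuous_comp _ _ _ (fun x : X => (x, c)) (fun z => z.1 - z.2)).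
    by apply: cvg_pair; [exact: cvg_id|exact: cvg_cst].
  exact: sub_continuous.
exact: cp.
Qed.

Lemma seminormN p (x : X) : continuous_seminorm p -> p (- x) = p x.
Proof. by move=> [_ _ pZ _]; rewrite -scaleN1r pZ normrN normr1 mul1r. Qed.

Lemma seminormBC p (x y : X) : continuous_seminorm p -> p (x - y) = p (y - x).
Proof. by move=> sp; rewrite -(seminormN _ sp) opprB. Qed.

Lemma seminorm0 p : continuous_seminorm p -> p 0 = 0.
Proof. by move=> [_ _ pZ _]; rewrite -(scale0r 0) pZ normr0 mul0r. Qed.

Lemma seminorm_triangle p (x y z : X) : continuous_seminorm p ->
  p (x - z) <= p (x - y) + p (y - z).
Proof.
by move=> [_ pD _ _]; rewrite (le_trans _ (pD _ _))// addrA subrK.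
Qed.

Lemma seminorm_lipschitz_continuous p (f : X -> R) : continuous_seminorm p ->
  (forall x y, `|f x - f y| <= p (x - y)) -> continuous f.
Proof.
move=> sp f_lip x; apply/cvgrPdist_le => d d0.
have cx : continuous (fun y => p (y - x)) by exact: seminorm_sub_continuous.
have : \forall y \near x, p (y - x) <= d.
  apply: (@cvgr_le _ _ _ _ (fun y => p (y - x)) _ (cx x)).
  by rewrite subrr seminorm0.
by apply: filterS => y; apply: le_trans; rewrite (seminormBC _ _ sp).
Qed.

Lemma compact_convex_comb (t : R) (A B : set X) :
  compact A -> compact B -> compact (convex_comb t A B).
Proof.
move=> cA cB.
have -> : convex_comb t A B =
    (fun z : X * X => t *: z.1 + (1 - t) *: z.2) @` (A `*` B).
  apply/seteqP; split=> [_ [a Aa [b Bb <-]]|_ [[a b] [/= Aa Bb] <-]].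
    by exists (a, b).
  by exists a => //; exists b.
apply: continuous_compact; last exact: compact_setX.
apply: continuous_subspaceT => z.
have scal (s : R) (h : X * X -> X) : h @ z --> h z ->
    (fun z => s *: h z) @ z --> s *: h z.
  move=> ch; apply: (@continuous2_cvg _ R^o X X _ _ (fun=> s) h
    (fun a b => a *: b)) => //.
    exact: (@scale_continuous R X (s, h z)).
  exact: cvg_cst.
apply: (@continuous2_cvg _ X X X _ _ (fun z => t *: z.1)
  (fun z => (1 - t) *: z.2) (fun a b => a + b)).
- exact: (@add_continuous X (t *: z.1, (1 - t) *: z.2)).
- by apply: scal; exact: cvg_fst.
- by apply: scal; exact: cvg_snd.
Qed.

Lemma radon_inner mu (B : set X) (e : R) : radon mu ->
  measurable (B : set (borel X)) -> 0 < e ->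
  exists K : set X, [/\ compact K, K `<=` B & fine (mu B) <= fine (mu K) + e].
Proof.
move=> mu_radon mB e0; have [K [cK KB] BK] := mu_radon _ mB _ e0.
exists K; split => //.
have mK : measurable (K : set (borel X)).
  by apply: closed_borel_measurable; exact: compact_closed.
have mBK : measurable (B `\` K : set (borel X)) by exact: measurableD.
rewrite -(setDUK KB) measureU//; last by rewrite setDIK.
rewrite fineD ?fin_num_measure// lerD2l.
by rewrite -lee_fin fineK ?fin_num_measure// ltW.
Qed.

(* If p(a - c) > 3u and p(b - c) <= u, the midpoint m of a and b satisfies
   p(m - c) > u. *)
Lemma log_concave_tail mu p (c : X) (u : R) :
  log_concave mu -> continuous_seminorm p ->
  fine (mu [set x | 3 * u < p (x - c)]) * fine (mu [set x | p (x - c) <= u]) <=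
  fine (mu [set x | u < p (x - c)]) ^+ 2.
Proof.
move=> [mu_radon mu_lc] sp.
have cphi : continuous (fun x => p (x - c)) by exact: seminorm_sub_continuous.
have mgt v : measurable ([set x | v < p (x - c)] : set (borel X)).
  exact: lt_preimage_measurable.
have mle v : measurable ([set x | p (x - c) <= v] : set (borel X)).
  exact: le_preimage_measurable.
have fine01 (B : set X) : measurable (B : set (borel X)) ->
    0 <= fine (mu B) <= 1.
  move=> mB; rewrite fine_ge0//= -lee_fin fineK ?fin_num_measure//.
  exact: probability_le1.
set A1 := [set x | 3 * u < p (x - c)]; set A2 := [set x | p (x - c) <= u].
set A3 := [set x | u < p (x - c)].
(* If compact sets lose at most [d] of each mass, the product of two masses in [0, 1] loses at most
   [2 * d + d ^+ 2], hence at most [3 * d <= e] because [d <= 1]. *)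
apply/ler_addgt0Pr => e e0; pose d := Num.min 1 (e / 3).
have d0 : 0 < d by rewrite lt_min ltr01 divr_gt0.
have d1 : d <= 1 by rewrite ge_min lexx.
have d3 : d <= e / 3 by rewrite ge_min lexx orbT.
have [K1 [cK1 K1A K1e]] := radon_inner mu_radon (mgt (3 * u)) d0.
have [K2 [cK2 K2A K2e]] := radon_inner mu_radon (mle u) d0.
have mK (K : set X) : compact K -> measurable (K : set (borel X)).
  by move=> cK; apply: closed_borel_measurable; exact: compact_closed.
have half : 0 < (2^-1 : R) < 1 by apply/andP; split; lra.
have := mu_lc K1 K2 2^-1 cK1 cK2 half.
have cC := @compact_convex_comb 2^-1 _ _ cK1 cK2.
have CA3 : convex_comb 2^-1 K1 K2 `<=` A3.
  move=> _ [a /K1A a1 [b /K2A b2 <-]]; rewrite /A3/=.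
  have [_ pD pZ _] := sp.
  (* With midpoint m, a - c = 2(m - c) + (c - b), so 3u < p(a - c) <= 2p(m - c) + u. *)
  have := pD (2 *: (2^-1 *: a + (1 - 2^-1) *: b - c)) (c - b).
  have -> : 2 *: (2^-1 *: a + (1 - 2^-1) *: b - c) + (c - b) = a - c.
    rewrite (_ : 1 - 2^-1 = 2^-1 :> R); last by lra.
    rewrite -scalerDr scalerBr scalerA mulfV ?pnatr_eq0// scale1r.
    rewrite scaler_nat mulr2n opprD -!addrA addKr.
    by rewrite (addrC (- c)) addNKr.
  rewrite pZ ger0_norm// (@seminormBC p c b sp).
  by move: a1 b2; rewrite /A1 /A2/=; lra.
have -> : 1 - 2^-1 = 2^-1 :> R by lra.
have := mK _ cC; have := mK _ cK1; have := mK _ cK2 => mK2 mK1 mC.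
have CA : fine (mu (convex_comb 2^-1 K1 K2)) <= fine (mu A3).
  have mA3 := mgt u; apply: fine_le; rewrite ?fin_num_measure//.
  by apply: le_measure; rewrite ?inE.
rewrite -(fineK (fin_num_measure mu _ mK1)) -(fineK (fin_num_measure mu _ mK2)).
rewrite -(fineK (fin_num_measure mu _ mC)) !poweR_EFin -EFinM lee_fin.
have := fine01 _ mK1; have := fine01 _ mK2; have := fine01 _ (mgt u).
have := fine01 _ (mgt (3 * u)); have := fine01 _ (mle u).
rewrite -/A1 -/A2 -/A3 => /andP[a20 a21] /andP[a10 a11] /andP[a30 a31].
move=> /andP[k20 k21] /andP[k10 k11].
rewrite !powR12_sqrt// => H.
have {}H : Num.sqrt (fine (mu K1)) * Num.sqrt (fine (mu K2)) <= fine (mu A3).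
  exact: le_trans H CA.
have : fine (mu K1) * fine (mu K2) <= fine (mu A3) ^+ 2.
  rewrite -(sqr_sqrtr k10) -(sqr_sqrtr k20) -exprMn.
  by rewrite ler_sqr ?nnegrE// mulr_ge0 ?sqrtr_ge0.
rewrite -/A1 -/A2 in K1e K2e.
by nra.
Qed.

End log_concave.

Section finite_measure_tail.
Context (R : realType) (X : tvsType R).
Implicit Types (m : {finite_measure set (borel X) -> \bar R}) (phi f : X -> R).

Definition tail m phi (u : R) : R := fine (m [set x | u < phi x]).

Lemma tail_ge0 m phi u : 0 <= tail m phi u.
Proof. by rewrite fine_ge0. Qed.

Lemma tail_cvg0 m phi : continuous phi ->
  forall e : R, 0 < e -> exists2 r, 0 < r & tail m phi r < e.
Proof.
move=> cphi e e0; pose F (n : nat) : set (borel X) := [set x | n%:R < phi x].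
have mF n : measurable (F n) by exact: lt_preimage_measurable.
have F0 : \bigcap_n F n = set0.
  rewrite -subset0 => x /(_ (Num.bound `|phi x|) I); rewrite /F/=.
  by apply/negP; rewrite -leNgt ltW// (le_lt_trans (ler_norm _))// archi_boundP.
have : m (F n) @[n --> \oo] --> m set0.
  rewrite -F0; apply: nonincreasing_cvg_mu => //.
  - by rewrite -ge0_fin_numE// fin_num_measure.
  - by rewrite F0.
  - move=> i j ij; apply/subsetPset => x; rewrite /F/=.
    by apply: le_lt_trans; rewrite ler_nat.
rewrite measure0 => /fine_cvgP[_].
(* Taking the level [n.+1] instead of [n] makes [r] positive. *)
move=> /cvgr_lt /(_ e e0)[n _ /(_ n.+1 (leqnSn n))] h.
by exists n.+1%:R; [rewrite ltr0n|].
Qed.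

Lemma continuous_bounded_integrable m f (M : R) :
  continuous f -> (forall x, `|f x| <= M) -> m.-integrable setT (EFin \o f).
Proof.
move=> cf fM; apply: (@bounded_integrable _ _ _ m f M) => //.
exact: continuous_borel_measurable.
Qed.

End finite_measure_tail.

(** * Moments through truncation at geometric levels *)

Section truncated_moments.
Context (R : realType) (X : tvsType R).
Implicit Types (m : {finite_measure set (borel X) -> \bar R}) (phi f : X -> R).

(** The levels grow by the factor 3 of the tail inequality. Truncating [phi] itself, rather than
    restricting the domain, keeps the integrand bounded and continuous, so that weak convergence
    applies to it. *)
Definition truncated_moment m phi (r : R) (k n : nat) : R :=
  \int[m]_x (Num.min (phi x) (3 ^+ n * r) ^+ k).

Variables (phi : X -> R) (r : R) (k : nat).
Hypotheses (phi_continuous : continuous phi) (phi_ge0 : forall x, 0 <= phi x).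
Hypothesis r_gt0 : 0 < r.

Let level_gt0 n : 0 < 3 ^+ n * r.
Proof. by rewrite mulr_gt0 ?exprn_gt0. Qed.

Let trunc_ge0 n x : 0 <= Num.min (phi x) (3 ^+ n * r).
Proof. by rewrite le_min phi_ge0 ltW. Qed.

Lemma truncated_power_continuous n :
  continuous (fun x => Num.min (phi x) (3 ^+ n * r) ^+ k).
Proof.
move=> x; apply: (@continuous_comp _ _ _ (fun x => Num.min (phi x) (3 ^+ n * r))
  (fun y => y ^+ k)); last exact: exprn_continuous.
by apply: continuous_min; [exact: phi_continuous|exact: cvg_cst].
Qed.

Lemma truncated_power_le n x :
  `|Num.min (phi x) (3 ^+ n * r) ^+ k| <= (3 ^+ n * r) ^+ k.
Proof.
rewrite ger0_norm ?exprn_ge0//; apply: lerXn2r; rewrite ?nnegrE//.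
  exact: ltW.
by rewrite ge_min lexx orbT.
Qed.

Lemma truncated_power_integrable m n : m.-integrable setT
  (EFin \o (fun x => Num.min (phi x) (3 ^+ n * r) ^+ k)).
Proof.
apply: (continuous_bounded_integrable m (@truncated_power_continuous n)).
exact: truncated_power_le.
Qed.

(** Consecutive truncations differ only where [phi] exceeds the lower level, and there the new
    integrand is at most the power of the higher level. *)
Lemma truncated_moment_step m n :
  truncated_moment m phi r k n.+1 <= truncated_moment m phi r k n +
    (3 ^+ n.+1 * r) ^+ k * tail m phi (3 ^+ n * r).
Proof.
pose A : set (borel X) := [set x | 3 ^+ n * r < phi x].
have mA : measurable A by exact: lt_preimage_measurable.
have iA : m.-integrable setT
    (EFin \o (fun x => (3 ^+ n.+1 * r) ^+ k * \1_A x)).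
  exact/EFin_integrableZl/integrable_indic.
have -> : (3 ^+ n.+1 * r) ^+ k * tail m phi (3 ^+ n * r) =
    \int[m]_x ((3 ^+ n.+1 * r) ^+ k * \1_A x).
  by rewrite RintegralZl// ?Rintegral_indic//; exact: integrable_indic.
rewrite /truncated_moment -RintegralD//; last exact: truncated_power_integrable.
apply: le_Rintegral => //; first exact: truncated_power_integrable.
  by apply: EFin_integrableD => //; exact: truncated_power_integrable.
move=> x _; rewrite indicE; case: (boolP (x \in A)) => [_|].
  rewrite mulr1 (le_trans (ler_norm _))//.
  by rewrite (le_trans (truncated_power_le n.+1 x))// lerDr exprn_ge0.
rewrite notin_setE /A/= => /negP; rewrite -leNgt mulr0 addr0 => h.
by rewrite (min_l h) min_l// (le_trans h)// ler_pM2r// ler_eXn2l ?ltr1n.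
Qed.

(** Monotone convergence in [n]. Integrability belongs to the conclusion because a real-valued
    integral alone would not detect an infinite moment. *)
Lemma moment_of_truncated_moments m (C : R) :
  (forall n, truncated_moment m phi r k n <= C) ->
  m.-integrable setT (EFin \o (fun x => phi x ^+ k)) /\
  \int[m]_x (phi x ^+ k) <= C.
Proof.
move=> mC; pose f n x := (Num.min (phi x) (3 ^+ n * r) ^+ k)%:E.
have mphi : measurable_fun [set: borel X] (fun x => (phi x ^+ k)%:E).
  apply/measurable_EFinP; apply: continuous_borel_measurable => x.
  apply: (@continuous_comp _ _ _ phi (fun y => y ^+ k)).
    exact: phi_continuous.
  exact: exprn_continuous.
have f_lim x : limn (f ^~ x) = (phi x ^+ k)%:E.
  apply/cvg_lim => //; apply: cvg_near_cst.
  (* Since [n < 3 ^ n], the truncation is inactive at [x] as soon as [n] reaches this bound. *)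
  exists (Num.bound (phi x / r)) => //.
  move=> n /= hn; rewrite /f min_l// -ler_pdivrMr//.
  rewrite (le_trans (ltW (archi_boundP _)))//; first by rewrite divr_ge0// ltW.
  by rewrite -natrX ler_nat (leq_trans hn)// ltnW// ltn_expl.
have f_mono x : {homo f ^~ x : a b / (a <= b)%N >-> (a <= b)%E}.
  move=> a b ab; rewrite lee_fin lerXn2r ?nnegrE//.
  rewrite le_min ge_min lexx/= ge_min ler_pM2r// ler_eXn2l ?ltr1n// ab.
  by rewrite orbT.
have lim_le : (\int[m]_x (phi x ^+ k)%:E <= C%:E)%E.
  have -> : (\int[m]_x (phi x ^+ k)%:E = \int[m]_x limn (f ^~ x))%E.
    by apply: eq_integral => x _; rewrite f_lim.
  have mono := @cvg_monotone_convergence _ _ _ m _ measurableT f.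
  have cv : (\int[m]_x f n x)%E @[n --> \oo] --> (\int[m]_x limn (f ^~ x))%E.
    apply: mono => //.
    - move=> n; apply/measurable_EFinP; apply: continuous_borel_measurable.
      exact: truncated_power_continuous.
    - by move=> n x _; rewrite lee_fin exprn_ge0.
  rewrite -(cvg_lim _ cv)//; apply: lime_le; first by apply: cvgP cv.
  apply: nearW => n; have := mC n; rewrite /truncated_moment -lee_fin.
  by rewrite fineK// integrable_fin_num//; exact: truncated_power_integrable.
have int : m.-integrable setT (EFin \o (fun x => phi x ^+ k)).
  apply/integrableP; split => //=; apply: le_lt_trans (ltry C).
  apply: le_trans lim_le.
  have <- : (\int[m]_x `|(phi x ^+ k)%:E| = \int[m]_x (phi x ^+ k)%:E)%E.
    by apply: eq_integral => x _; rewrite gee0_abs// lee_fin exprn_ge0.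
  exact: lexx.
by split => //; rewrite -lee_fin fineK// integrable_fin_num.
Qed.

End truncated_moments.

Section log_concave_moments.
Context (R : realType) (X : tvsType R).
Hypothesis X_hausdorff : hausdorff_space X.
Implicit Types (mu : probability (borel X) R) (p : X -> R).

(** With a and b the tails at [u] and [3 * u], the tail inequality gives b(1 - a) <= a^2 <= eta a,
    and 1 - a >= 1/2. *)
Lemma log_concave_tail3 mu p (c : X) (u eta : R) :
  log_concave mu -> continuous_seminorm p -> eta <= 2^-1 ->
  tail mu (fun x => p (x - c)) u <= eta ->
  tail mu (fun x => p (x - c)) (3 * u) <=
    2 * eta * tail mu (fun x => p (x - c)) u.
Proof.
move=> lc sp eta12 tail_eta.
have cphi : continuous (fun x => p (x - c)) by exact: seminorm_sub_continuous.
have := log_concave_tail X_hausdorff c u lc sp.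
have -> : [set x | p (x - c) <= u] =
    ~` [set x | u < p (x - c)] :> set (borel X).
  by apply/seteqP; split => x /= => [?|/negP]; [apply/negP|]; rewrite -leNgt.
rewrite probability_setC; last exact: lt_preimage_measurable.
rewrite fineB ?fin_num_measure//; last exact: lt_preimage_measurable.
have := tail_ge0 mu (fun x => p (x - c)) u.
have := tail_ge0 mu (fun x => p (x - c)) (3 * u).
move: tail_eta; rewrite -!/(tail mu (fun x => p (x - c)) _).
rewrite (_ : fine 1%E = 1 :> R)//.
move: (tail mu _ u) (tail mu _ (3 * u)) => a b a_eta b0 a0 h.
have : a * a <= eta * a by rewrite ler_wpM2r.
have : b * 2^-1 <= b * (1 - a) by rewrite ler_wpM2l//; lra.
by move: h; rewrite expr2; lra.
Qed.

(** The threshold makes [3 ^+ k * eta] equal to 1/4: each step multiplies the power by [3 ^+ k] and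
    the tail bound by [2 * eta], so the increments of the truncated moments are dominated by a
    geometric series of ratio 1/2. *)
Lemma log_concave_truncated_moment mu p (c : X) (k n : nat) (r : R) :
  log_concave mu -> continuous_seminorm p -> 0 < r ->
  tail mu (fun x => p (x - c)) r <= (4 * 3 ^+ k)^-1 ->
  truncated_moment mu (fun x => p (x - c)) r k n <= 2 * r ^+ k.
Proof.
move=> lc sp r0; set eta := (4 * 3 ^+ k)^-1; set phi := fun x => _ => tr.
have cphi : continuous phi by exact: seminorm_sub_continuous.
have phi0 x : 0 <= phi x by have [h _ _ _] := sp; exact: h.
have k3 : 1 <= 3 ^+ k :> R by rewrite exprn_ege1// ler1n.
have eta0 : 0 < eta by rewrite invr_gt0 mulr_gt0// exprn_gt0.
have eta3 : 3 ^+ k * eta = 4^-1.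
  by rewrite /eta invfM mulrCA divff ?mulr1// gt_eqF// exprn_gt0.
have eta4 : eta <= 4^-1.
  by rewrite -eta3 ler_peMl// ltW.
(* The cruder second bound is carried along because it is the hypothesis of [log_concave_tail3] at
   the next level. *)
have tails j : tail mu phi (3 ^+ j * r) <= eta * (2 * eta) ^+ j /\
    tail mu phi (3 ^+ j * r) <= eta.
  elim: j => [|j [IH1 IH2]]; first by rewrite !expr0 mul1r mulr1.
  have eta2 : eta <= 2^-1 by lra.
  have := log_concave_tail3 lc sp eta2 IH2; rewrite mulrA -exprS -/phi => h.
  have t0 := tail_ge0 mu phi (3 ^+ j * r).
  split; last by rewrite (le_trans h)//; nra.
  by rewrite (le_trans h)// exprS mulrCA ler_pM2l// mulr_gt0.
(* The bracket is the partial sum 1 + 1/4 + 1/8 + ..., with [n] terms after the 1. *)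
suff : truncated_moment mu phi r k n <= r ^+ k * (3 / 2 - (2^-1) ^+ n.+1).
  move=> /le_trans; apply; rewrite mulrC ler_pM2r ?exprn_gt0//.
  by have : 0 < (2^-1 : R) ^+ n.+1 by []; lra.
elim: n => [|n IH].
  rewrite expr1 (_ : 3 / 2 - 2^-1 = 1); last by lra.
  rewrite mulr1 /truncated_moment expr0 mul1r.
  have -> : r ^+ k = \int[mu]_(x in [set: borel X]) (r ^+ k).
    have mu1 : fine (mu setT) = 1 by rewrite probability_setT.
    by rewrite Rintegral_cst// [fine _]mu1 mulr1.
  have := @truncated_power_integrable _ _ phi r k cphi phi0 r0 mu 0.
  rewrite expr0 mul1r => int0.
  apply: le_Rintegral => //.
    apply: (@continuous_bounded_integrable _ _ _ _ (r ^+ k)) => x.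
      exact: cvg_cst.
    by rewrite ger0_norm// exprn_ge0// ltW.
  move=> x _; have := @truncated_power_le _ _ phi r k phi0 r0 0 x.
  by rewrite expr0 mul1r; exact/le_trans/ler_norm.
apply: le_trans (@truncated_moment_step _ _ phi r k cphi phi0 r0 mu n) _.
have : (3 ^+ n.+1 * r) ^+ k * tail mu phi (3 ^+ n * r) <=
    r ^+ k * (4^-1 * 2^-1 ^+ n).
  rewrite (@le_trans _ _ ((3 ^+ n.+1 * r) ^+ k * (eta * (2 * eta) ^+ n)))//.
    by rewrite ler_wpM2l ?(tails n).1// exprn_ge0// mulr_ge0 ?exprn_ge0// ltW.
  rewrite exprMn mulrAC mulrC ler_pM2l ?exprn_gt0//.
  have -> : (3 ^+ n.+1) ^+ k = 3 ^+ k * (3 ^+ k) ^+ n :> R.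
    by rewrite -exprM mulnC exprM exprS.
  rewrite mulrACA -exprMn eta3 mulrCA eta3.
  by rewrite (_ : 2 * 4^-1 = 2^-1 :> R)//; lra.
have -> : 4^-1 * 2^-1 ^+ n = 2^-1 ^+ n.+1 - 2^-1 ^+ n.+2 :> R.
  by rewrite !exprS; field.
by move: IH; rewrite !mulrBr; lra.
Qed.

End log_concave_moments.

(** * Uniform convergence over Lipschitz functions *)

Section lipschitz_partition.
Context (R : realType) (X : tvsType R).
Implicit Types (p : X -> R).

Lemma continuous_seq_sum (A : Type) (s : seq A) (h : A -> X -> R) :
  (forall a, continuous (h a)) -> continuous (fun y => \sum_(a <- s) h a y).
Proof.
by move=> ch; apply: continuous_big => // z; exact: add_continuous.
Qed.

(** Near-covering compactness is applied along finite sequences directed by inclusion, so one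
    sequence long enough for all of [K] appears directly. *)
Lemma seminorm_net p (K : set X) (r : R) : continuous_seminorm p ->
  compact K -> 0 < r ->
  exists s : seq X, forall y, K y -> exists2 x, x \in s & p (y - x) < r.
Proof.
move=> sp /compact_near_coveringP cK r0.
have dir : directed_preorder (fun s t : seq X => {subset s <= t}).
  split; first exact: (inhabits [::]).
  - by move=> s x.
  - by move=> s t u st tu x /st /tu.
  - by move=> s t; exists (s ++ t); split=> x xst; rewrite mem_cat xst ?orbT.
have FF := tails_proper_filter dir.
have : \forall s \near tails (fun s t : seq X => {subset s <= t}),
    K `<=` (fun y => exists2 x, x \in s & p (y - x) < r).
  apply: cK => x Kx.
  have cx : continuous (fun y => p (y - x)) by exact: seminorm_sub_continuous.
  exists ([set y | p (y - x) < r], [set s : seq X | x \in s]); last first.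
    by move=> [y s] [/= yx xs]; exists x.
  split; last by exists [:: x] => s; apply; rewrite mem_head.
  apply: (@cvgr_lt _ _ _ _ (fun y => p (y - x)) _ (cx x)).
  by rewrite subrr seminorm0.
by move=> near_s; have [s sK] := @filter_ex _ _ FF _ near_s; exists s.
Qed.

(** Tent functions of radius [r] around a net of mesh [r / 2], divided by their sum: every point of
    [K] has a tent of height at least 1/2 above it. *)
Lemma lipschitz_partition p (K : set X) (r : R) : continuous_seminorm p ->
  compact K -> 0 < r ->
  exists (s : seq X) (phi : X -> X -> R),
    [/\ forall x, continuous (phi x), forall x y, 0 <= phi x y,
        forall x y, r <= p (y - x) -> phi x y = 0,
        forall y, \sum_(x <- s) phi x y <= 1 &
        forall y, K y -> \sum_(x <- s) phi x y = 1].
Proof.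
move=> sp cK r0; have r20 : 0 < r / 2 by rewrite divr_gt0.
have [s sK] := seminorm_net sp cK r20.
pose psi x y := Num.max 0 (1 - p (y - x) / r).
pose S y := \sum_(x <- s) psi x y.
(* The floor 1/2 keeps the denominator positive and continuous off [K], and is inactive on [K],
   where [S] is at least 1/2. *)
pose D y := Num.max (S y) 2^-1.
have cpsi x : continuous (psi x).
  have cx : continuous (fun y => p (y - x)) by exact: seminorm_sub_continuous.
  move=> y; apply: (@continuous_max _ _ (cst 0) (fun y => 1 - p (y - x) / r)).
    exact: cvg_cst.
  by apply: cvgB; [exact: cvg_cst|apply: cvgM; [exact: cx|exact: cvg_cst]].
have psi0 x y : 0 <= psi x y by rewrite le_max lexx.
have cS : continuous S by exact: continuous_seq_sum.
have D2 y : 2^-1 <= D y by rewrite le_max lexx orbT.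
have D0 y : 0 < D y by rewrite (lt_le_trans _ (D2 y)).
have cD : continuous D.
  move=> y; apply: (@continuous_max _ _ S (cst _)); first exact: cS.
  exact: cvg_cst.
exists s, (fun x y => psi x y / D y).
have sumE y : \sum_(x <- s) (psi x y / D y) = S y / D y by rewrite -mulr_suml.
split.
- move=> x y; apply: cvgM; first exact: cpsi.
  by apply: cvgV; [rewrite gt_eqF|exact: cD].
- by move=> x y; rewrite divr_ge0// ltW.
- move=> x y rp; rewrite /psi max_l ?mul0r// subr_le0 ler_pdivlMr//.
  by rewrite mul1r.
- by move=> y; rewrite sumE ler_pdivrMr// mul1r le_max lexx.
- move=> y Ky; have [x xs pyx] := sK y Ky; rewrite sumE.
  suff SD : D y = S y by rewrite SD divff// -SD gt_eqF.
  rewrite /D max_l// /S big_mkcond (big_rem x)//=.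
  rewrite -[2^-1]addr0; apply: lerD; last by apply: sumr_ge0.
  rewrite le_max; apply/orP; right.
  suff : p (y - x) / r <= 2^-1 by lra.
  by rewrite ler_pdivrMr// mulrC ltW.
Qed.

End lipschitz_partition.

(** * Truncating a square-integrable weight *)

Section square_integrable_weight.
Context (R : realType) (X : tvsType R).
Implicit Types (n : {finite_measure set (borel X) -> \bar R}).
Implicit Types (u f g : X -> R).

Lemma Rintegral_lincomb n (s : seq X) (c : X -> R) (h : X -> X -> R) :
  (forall x, n.-integrable setT (EFin \o h x)) ->
  n.-integrable setT (EFin \o (fun y => \sum_(x <- s) c x * h x y)) /\
  \int[n]_y (\sum_(x <- s) c x * h x y) = \sum_(x <- s) c x * \int[n]_y h x y.
Proof.
move=> nh; elim: s => [|a s [IH1 IH2]].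
  rewrite big_nil; under eq_Rintegral do rewrite big_nil.
  rewrite Rintegral_cst// mul0r; split => //.
  have -> : (fun y : X => \sum_(x <- [::]) c x * h x y) = cst 0.
    by apply/funext => y; rewrite big_nil.
  exact: integrable0.
have -> : (fun y : X => \sum_(x <- a :: s) c x * h x y) =
    (fun y => c a * h a y + \sum_(x <- s) c x * h x y).
  by apply/funext => y; rewrite big_cons.
have ia : n.-integrable setT (EFin \o (fun y => c a * h a y)).
  exact: EFin_integrableZl.
split; first exact: EFin_integrableD.
by rewrite RintegralD// RintegralZl// IH2 big_cons.
Qed.

(** A second moment bound makes the truncation error of [g] at level [N] at most [C / N], uniformly
    over all measures sharing [C]. Integrability is bundled in because the real-valued integral of a
    function with infinite integral is 0. *)
Definition square_integral_le n g (C : R) :=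
  n.-integrable setT (EFin \o (fun x => g x ^+ 2)) /\
  \int[n]_x (g x ^+ 2) <= C.

Variables (g : X -> R) (g_cont : continuous g) (g_ge1 : forall x, 1 <= g x).

Let g_ge0 x : 0 <= g x. Proof. exact: le_trans (g_ge1 x). Qed.

Lemma mul_weight_integrable n u (M C : R) : square_integral_le n g C ->
  continuous u -> (forall x, `|u x| <= M) ->
  n.-integrable setT (EFin \o (fun x => u x * g x)).
Proof.
move=> [ng _] cu uM.
apply: (@dominated_integrable _ _ _ n _ (fun x => M * g x ^+ 2)).
- apply: continuous_borel_measurable => x.
  by apply: cvgM; [exact: cu|exact: g_cont].
- move=> x; rewrite normrM (ger0_norm (g_ge0 x)).
  rewrite ler_pM// expr2 ler_peMr//.
- exact: EFin_integrableZl.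
Qed.

Lemma weight_integrable n (C : R) : square_integral_le n g C ->
  n.-integrable setT (EFin \o g).
Proof.
move=> nC; have := @mul_weight_integrable n (cst 1) 1 C nC.
rewrite (_ : (fun x => cst 1 x * g x) = g).
  by apply; [move=> x; exact: cvg_cst|move=> x; rewrite normr1].
by apply/funext => x; rewrite mul1r.
Qed.

Let trunc (N : R) x := Num.min (g x) N.

Lemma trunc_weight_continuous (N : R) : continuous (trunc N).
Proof.
by move=> x; apply: continuous_min; [exact: g_cont|exact: cvg_cst].
Qed.

Lemma trunc_weight_bound (N : R) x : 0 <= N -> `|trunc N x| <= N.
Proof.
move=> N0; rewrite ger0_norm; first by rewrite ge_min lexx orbT.
by rewrite le_min g_ge0.
Qed.

(** The difference vanishes where [g <= N]; elsewhere it is at most [g], which is below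
    [g ^+ 2 / N]. *)
Lemma trunc_weight_error (N : R) x : 0 < N ->
  0 <= g x - trunc N x <= g x ^+ 2 / N.
Proof.
move=> N0; rewrite /trunc subr_ge0 ge_min lexx/=.
have [gN|Ng] := leP (g x) N.
  by rewrite subrr divr_ge0// ?sqr_ge0// ltW.
rewrite ler_pdivlMr// expr2 (@le_trans _ _ (g x * N))//.
  by rewrite ler_pM2r// gerBl ltW.
by rewrite ler_wpM2l// ltW.
Qed.

Lemma truncation_error n u (M C N : R) : square_integral_le n g C -> 0 < N ->
  continuous u -> (forall x, `|u x| <= M) ->
  `| \int[n]_x (u x * g x) - \int[n]_x (u x * Num.min (g x) N) | <= M * C / N.
Proof.
move=> nC N0 cu uM; have [ng ngC] := nC.
have M0 : 0 <= M by apply: le_trans (uM 0).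
have i1 := mul_weight_integrable nC cu uM.
have i2 : n.-integrable setT (EFin \o (fun x => u x * trunc N x)).
  apply: (@continuous_bounded_integrable _ _ _ _ (M * N)) => x.
    by apply: cvgM; [exact: cu|exact: trunc_weight_continuous].
  by rewrite normrM ler_pM// trunc_weight_bound// ltW.
rewrite -RintegralB//.
have i3 := EFin_integrableB i1 i2.
apply: le_trans (le_normr_Rintegral measurableT i3) _.
apply: (@le_trans _ _ (\int[n]_x (M / N * g x ^+ 2))); last first.
  by rewrite RintegralZl// (mulrAC M C) ler_wpM2l// divr_ge0// ltW.
apply: le_Rintegral => //.
- have := integrable_abse i3; apply: eq_integrable => // x _.
- exact: EFin_integrableZl.
- move=> x _; rewrite -mulrBr normrM mulrAC -mulrA.
  have /andP[e0 e1] := trunc_weight_error x N0.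
  by rewrite ler_pM// ger0_norm.
Qed.

End square_integrable_weight.

Section powR_weight.
Context (R : realType) (X : tvsType R).
Implicit Types (phi : X -> R).

Lemma powR_comp_continuous phi (q : R) : 1 <= q -> continuous phi ->
  (forall x, 0 <= phi x) -> continuous (fun x => phi x `^ q).
Proof.
move=> q1 cphi phi0 x; have q0 : 0 < q by rewrite (lt_le_trans ltr01).
have [x0|x0] := eqVneq (phi x) 0.
  apply/cvgrPdist_le => e e0; rewrite x0 powR0 ?gt_eqF//.
  have : \forall y \near x, phi y <= Num.min 1 e.
    by apply: (@cvgr_le _ _ _ _ phi _ (cphi x)); rewrite x0 lt_min ltr01.
  apply: filterS => y; rewrite le_min => /andP[y1 ye].
  rewrite sub0r normrN ger0_norm ?powR_ge0// (le_trans _ ye)//.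
  have [->|y0] := eqVneq (phi y) 0; first by rewrite powR0// gt_eqF.
  by apply: ge1r_powR => //; rewrite lt_neqAle eq_sym y0 phi0.
apply: (@continuous_comp _ _ _ phi (fun y => y `^ q)); first exact: cphi.
apply: differentiable_continuous; apply/derivable1_diffP.
by apply: derivable_powR; rewrite in_itv/= andbT lt_neqAle eq_sym x0 phi0.
Qed.

Lemma powR_le1Xn (a q : R) (k : nat) : 0 <= a -> 0 <= q -> q <= k%:R ->
  a `^ q <= 1 + a ^+ k.
Proof.
move=> a0 q0 qk; have [a1|/ltW a1] := leP a 1.
  have : a `^ q <= 1 `^ q by apply: ge0_ler_powR; rewrite ?nnegrE.
  by rewrite powR1 => /le_trans; apply; rewrite lerDl exprn_ge0.
by rewrite -powR_mulrn// (le_trans (ler_powR a1 qk))// lerDr.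
Qed.

(** With d = [a ^+ k], the left side is at most (2 + d)^2 = 8 + 2d^2 - (2 - d)^2. *)
Lemma sqr_weight_le (a q : R) (k : nat) : 0 <= a -> 0 <= q -> q <= k%:R ->
  (1 + a `^ q) ^+ 2 <= 8 + 2 * a ^+ (k * 2).
Proof.
move=> a0 q0 qk; have := powR_le1Xn a0 q0 qk; have := powR_ge0 a q.
rewrite exprM; have := exprn_ge0 k a0; move: (a `^ q) (a ^+ k) => b d.
move=> d0 b0 bd; have : (1 + b) ^+ 2 <= (2 + d) ^+ 2.
  by rewrite ler_sqr ?nnegrE; lra.
have := sqr_ge0 (2 - d); rewrite !expr2; lra.
Qed.

End powR_weight.

(** * Tightness and moments along a weakly convergent net *)

Section weak_limit.
Context (R : realType) (X : tvsType R).
Hypothesis X_hausdorff : hausdorff_space X.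
Context (I : Type) (F : set_system I) {FF : ProperFilter F}.
Variables (mu_ : I -> probability (borel X) R).
Variable (m : {finite_measure set (borel X) -> \bar R}).
Hypothesis mu_cvg : forall f : X -> R, continuous f ->
  (exists M : R, forall x, `|f x| <= M) ->
  \int[mu_ i]_x f x @[i --> F] --> \int[m]_x f x.

(** Indicators cannot be tested against weak convergence, so a continuous ramp [h] from level [r] to
    [r + 1] is used: it is dominated by the indicator of [phi > r] and equals 1 where
    [phi > r + 1]. *)
Lemma tight_near (phi : X -> R) (eta : R) : continuous phi -> 0 < eta ->
  exists2 r, 0 < r & \forall i \near F, tail (mu_ i) phi r <= eta.
Proof.
move=> cphi eta0; have [r r0 tr] := tail_cvg0 m cphi eta0.
exists (r + 1); first by rewrite addr_gt0.
pose h x := Num.min 1 (Num.max 0 (phi x - r)).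
have ch : continuous h.
  move=> x.
  apply: (@continuous_min _ _ (cst 1) (fun x => Num.max 0 (phi x - r))).
    exact: cvg_cst.
  apply: (@continuous_max _ _ (cst 0) (fun x => phi x - r)).
    exact: cvg_cst.
  by apply: cvgB; [exact: cphi|exact: cvg_cst].
have h0 x : 0 <= h x by rewrite le_min ler01/= le_max lexx.
have h1 x : `|h x| <= 1 by rewrite ger0_norm// ge_min lexx.
have mA u : measurable ([set x | u < phi x] : set (borel X)).
  exact: lt_preimage_measurable.
have hm : \int[m]_x h x < eta.
  apply: le_lt_trans tr; rewrite /tail -Rintegral_indic//.
  apply: le_Rintegral => //.
  - exact: (continuous_bounded_integrable m ch h1).
  - exact: integrable_indic.
  move=> x _; rewrite indicE; case: (boolP (x \in _)) => [_|].
    by rewrite (le_trans (ler_norm _)).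
  rewrite notin_setE/= => /negP; rewrite -leNgt => phir.
  by rewrite /h max_l ?subr_le0// ge_min lexx orbT.
have cv := mu_cvg ch (ex_intro _ 1 h1).
have near_i : \forall i \near F, \int[mu_ i]_x h x < eta.
  exact: (@cvgr_lt _ _ _ _ _ _ cv).
apply: filterS near_i => i /ltW; apply: le_trans.
rewrite /tail -Rintegral_indic//; apply: le_Rintegral => //.
- exact: integrable_indic.
- exact: (continuous_bounded_integrable (mu_ i) ch h1).
move=> x _; rewrite indicE; case: (boolP (x \in _)) => [|_]; last exact: h0.
rewrite inE/= => phir; rewrite /h le_min lexx/= le_max; apply/orP; right.
by lra.
Qed.

Section moments.
Hypothesis mu_lc : forall i, log_concave (mu_ i).
Variables (p : X -> R) (c : X).
Hypothesis sp : continuous_seminorm p.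
Let phi x := p (x - c).

Let cphi : continuous phi. Proof. exact: seminorm_sub_continuous. Qed.

Let phi0 x : 0 <= phi x. Proof. by have [h _ _ _] := sp; exact: h. Qed.

(** Here [r] may depend on [i]: every measure of the net, not only those far along it, must have
    moments in order to lie in the space. *)
Lemma log_concave_power_integrable i (k : nat) :
  (mu_ i).-integrable setT (EFin \o (fun x => phi x ^+ k)).
Proof.
have eta0 : 0 < (4 * 3 ^+ k)^-1 :> R by rewrite invr_gt0 mulr_gt0// exprn_gt0.
have [r r0 /ltW tr] := tail_cvg0 (mu_ i) cphi eta0.
have mom n : truncated_moment (mu_ i) phi r k n <= 2 * r ^+ k.
  exact: log_concave_truncated_moment.
have moment := @moment_of_truncated_moments _ _ phi r k cphi phi0 r0.
by have [] := moment (mu_ i) _ mom.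
Qed.

(** One [r] from tightness serves eventually, and the moment bound depends on [r] and [k] only. The
    limit inherits it on each truncated moment, an integral of a bounded continuous function, and
    then by monotone convergence. *)
Lemma moments_near (k : nat) : exists C : R,
  (\forall i \near F, \int[mu_ i]_x (phi x ^+ k) <= C) /\
  m.-integrable setT (EFin \o (fun x => phi x ^+ k)) /\
  \int[m]_x (phi x ^+ k) <= C.
Proof.
have eta0 : 0 < (4 * 3 ^+ k)^-1 :> R by rewrite invr_gt0 mulr_gt0// exprn_gt0.
have [r r0 tr] := tight_near cphi eta0; exists (2 * r ^+ k).
have moment := @moment_of_truncated_moments _ _ phi r k cphi phi0 r0.
have mom : \forall i \near F, forall n,
    truncated_moment (mu_ i) phi r k n <= 2 * r ^+ k.
  apply: filterS tr => i tri n; exact: log_concave_truncated_moment.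
split.
  apply: filterS mom => i mi.
  by have [] := moment (mu_ i) _ mi.
apply: moment => n.
have cv := mu_cvg (@truncated_power_continuous _ _ phi r k cphi n)
  (ex_intro _ _ (@truncated_power_le _ _ phi r k phi0 r0 n)).
rewrite /truncated_moment -(cvg_lim _ cv)//.
apply: limr_le; first exact: cvgP cv.
by apply: filterS mom => i; exact.
Qed.

Lemma weight_square_integral (q : R) : 0 <= q -> exists C : R,
  (\forall i \near F, square_integral_le (mu_ i) (fun x => 1 + phi x `^ q) C) /\
  square_integral_le m (fun x => 1 + phi x `^ q) C.
Proof.
move=> q0; pose k := Num.bound q.
have qk : q <= k%:R by rewrite ltW// archi_boundP.
have [C [C1 [C2 C3]]] := moments_near (k * 2).
pose g2 x := (1 + phi x `^ q) ^+ 2.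
have mg2 : measurable_fun [set: borel X] g2.
  apply: measurable_funX; apply: measurable_funD => //.
  exact: (measurableT_comp (measurable_powR q)
    (continuous_borel_measurable cphi)).
have main (n : {finite_measure set (borel X) -> \bar R}) (D : R) :
    n.-integrable setT (EFin \o (fun x => phi x ^+ (k * 2))) ->
    fine (n setT) <= D -> \int[n]_x (phi x ^+ (k * 2)) <= C ->
    square_integral_le n (fun x => 1 + phi x `^ q) (8 * D + 2 * C).
  move=> int nD nC.
  have int8 : n.-integrable setT (EFin \o (fun x : borel X => 8 : R)).
    by apply: (@bounded_integrable _ _ _ n _ 8) => // x; rewrite ger0_norm.
  have int2 := EFin_integrableZl 2 int.
  have le2 x : g2 x <= 8 + 2 * phi x ^+ (k * 2) by exact: sqr_weight_le.
  have intg : n.-integrable setT (EFin \o g2).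
    apply: dominated_integrable (EFin_integrableD int8 int2) => // x.
    by rewrite ger0_norm ?sqr_ge0//; exact: le2.
  split => //; apply: (@le_trans _ _ (\int[n]_x (8 + 2 * phi x ^+ (k * 2)))).
    apply: le_Rintegral => //; first exact: (EFin_integrableD int8 int2).
    by move=> x _; exact: le2.
  by rewrite RintegralD// RintegralZl// Rintegral_cst//; lra.
(* The maximum bounds the total masses of the probabilities and of [m] at once. *)
exists (8 * Num.max 1 (fine (m setT)) + 2 * C); split.
  apply: filterS C1 => i C1i; apply: main => //.
    exact: log_concave_power_integrable.
  have mu1 : fine (mu_ i setT) = 1 by rewrite probability_setT.
  by rewrite [fine _]mu1 le_max lexx.
by apply: main => //; rewrite le_max lexx orbT.
Qed.

Lemma log_concave_weight_integrable i (q : R) : 0 <= q ->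
  (mu_ i).-integrable setT (EFin \o (fun x => phi x `^ q)).
Proof.
move=> q0; have qk : q <= (Num.bound q)%:R by rewrite ltW// archi_boundP.
have int1 : (mu_ i).-integrable setT (EFin \o (fun x : borel X => 1 : R)).
  by apply: (@bounded_integrable _ _ _ (mu_ i) _ 1) => // x; rewrite normr1.
apply: dominated_integrable
  (EFin_integrableD int1 (@log_concave_power_integrable i (Num.bound q))).
  exact: (measurableT_comp (measurable_powR q)
    (continuous_borel_measurable cphi)).
by move=> x; rewrite ger0_norm ?powR_ge0//; exact: powR_le1Xn.
Qed.

End moments.

(** * Convergence of weighted integrals *)

Section weighted_convergence.
Variables (g : X -> R) (C : R).
Hypotheses (g_cont : continuous g) (g_ge1 : forall x, 1 <= g x).
Hypothesis mu_gC : \forall i \near F, square_integral_le (mu_ i) g C.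
Hypothesis m_gC : square_integral_le m g C.

Let C_ge0 : 0 <= C.
Proof.
have [_] := m_gC; apply: le_trans.
by apply: Rintegral_ge0 => x _; exact: sqr_ge0.
Qed.

(** Replacing [g] by its truncation at [N] costs at most [e / 3] for [m] and, eventually, for
    [mu_ i]; the truncated integrand is bounded and continuous. *)
Lemma weighted_cvg (u : X -> R) (M : R) :
  continuous u -> (forall x, `|u x| <= M) ->
  \int[mu_ i]_x (u x * g x) @[i --> F] --> \int[m]_x (u x * g x).
Proof.
move=> cu uM; have M0 : 0 <= M by apply: le_trans (uM 0).
apply/cvgrPdist_le => e e0.
pose N := 3 * (M * C + 1) / e.
have MC0 : 0 <= M * C by rewrite mulr_ge0.
have N0 : 0 < N by rewrite divr_gt0// mulr_gt0// ltr_wpDl.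
have MCN : M * C / N <= e / 3.
  rewrite ler_pdivrMr// /N (_ : e / 3 * _ = M * C + 1); first by rewrite lerDl.
  by field; rewrite gt_eqF.
have cgN : continuous (fun x => u x * Num.min (g x) N).
  by move=> x; apply: cvgM; [exact: cu|exact: trunc_weight_continuous].
have bgN x : `|u x * Num.min (g x) N| <= M * N.
  by rewrite normrM ler_pM// trunc_weight_bound// ltW.
have e30 : 0 < e / 3 by rewrite divr_gt0.
have /cvgrPdist_le/(_ _ e30) := mu_cvg cgN (ex_intro _ _ bgN).
apply: filterS2 mu_gC => i mui cvi.
have := truncation_error g_cont g_ge1 mui N0 cu uM.
have := truncation_error g_cont g_ge1 m_gC N0 cu uM.
move: cvi MCN; rewrite !ler_norml.
by move=> /andP[? ?] ? /andP[? ?] /andP[? ?]; apply/andP; split; lra.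
Qed.

(* A 1-Lipschitz f with |f| <= 1 is within r + (1 - sum phi_x) of the
   combination sum f(x) phi_x, whose functions phi_x do not depend on f. *)
Lemma weighted_cvg_uniform (p : X -> R) (e : R) :
  continuous_seminorm p -> radon m -> 0 < e ->
  \forall i \near F, forall f : X -> R,
    (forall x y, `|f x - f y| <= p (x - y)) -> (forall x, `|f x| <= 1) ->
    `| \int[mu_ i]_x (f x * g x) - \int[m]_x (f x * g x) | <= e.
Proof.
move=> sp m_radon e0; have g_ge0 x : 0 <= g x by exact: le_trans (g_ge1 x).
pose A := \int[m]_x g x.
have A0 : 0 <= A by exact: Rintegral_ge0.
have ig := weight_integrable g_cont g_ge1 m_gC.
(* The added 1 keeps the denominator positive when [A] is 0; likewise it keeps [N] positive when [C]
   is 0. *)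
pose r := e / (9 * (A + 1)).
have r0 : 0 < r by rewrite divr_gt0// mulr_gt0// ltr_wpDl.
have rA : r * A <= e / 9.
  rewrite /r mulrAC ler_pdivrMr; last by rewrite mulr_gt0// ltr_wpDl.
  by rewrite (_ : e / 9 * _ = e * (A + 1)); [rewrite ler_pM2l// lerDl|field].
pose N := 9 * (C + 1) / e.
have N0 : 0 < N by rewrite divr_gt0// mulr_gt0// ltr_wpDl.
have CN : C / N <= e / 9.
  rewrite ler_pdivrMr// /N (_ : e / 9 * _ = C + 1); first by rewrite lerDl.
  by field; rewrite gt_eqF.
(* Off [K] the weight is split as at most [N] plus [g ^+ 2 / N], so the mass there has to be small
   relative to [N]. *)
have eN0 : 0 < e / 9 / N by do 2!apply: divr_gt0 => //.
have [K [cK _]] := m_radon _ measurableT _ eN0.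
rewrite setTD => mK.
have mKc : measurable (~` K : set (borel X)).
  apply: measurableC; apply: closed_borel_measurable.
  exact: compact_closed.
have [s [phi [cphi phi0 phi_r phi_le1 phi_K]]] := lipschitz_partition sp cK r0.
(* This majorant of the approximation error does not depend on [f] and is bounded and continuous, so
   its weighted integrals under [mu_ i] converge too. *)
pose w x := r + (1 - \sum_(a <- s) phi a x).
have w_ge0 x : 0 <= w x by rewrite addr_ge0 ?(ltW r0)// subr_ge0.
have cw : continuous w.
  move=> x; apply: cvgD; first exact: cvg_cst.
  by apply: cvgB; [exact: cvg_cst|exact: continuous_seq_sum].
have w_le x : `|w x| <= r + 1.
  rewrite ger0_norm// lerD2l lerBlDr lerDl.
  by apply: sumr_ge0.
(* The bound by 1 comes from the sum over [s], hence is available only for centres in [s]; elsewhere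
   the function is set to 0. *)
pose Phi a x := if a \in s then phi a x else 0.
have cPhi a : continuous (Phi a).
  rewrite /Phi; case: (a \in s); first exact: cphi.
  by move=> x; exact: cvg_cst.
have Phi_le1 a x : `|Phi a x| <= 1.
  rewrite /Phi; case: ifPn => [as_|_]; last by rewrite normr0.
  rewrite ger0_norm// (le_trans _ (phi_le1 x))//.
  by rewrite (big_rem a)//= lerDl sumr_ge0.
have approx (n : {finite_measure set (borel X) -> \bar R}) (f : X -> R) :
    square_integral_le n g C ->
    (forall x y, `|f x - f y| <= p (x - y)) -> (forall x, `|f x| <= 1) ->
    `| \int[n]_x (f x * g x) -
       \sum_(a <- s) f a * \int[n]_x (Phi a x * g x) | <=
    \int[n]_x (w x * g x).
  move=> ng f_lip f_le1.
  have cf := seminorm_lipschitz_continuous sp f_lip.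
  have ifg := mul_weight_integrable g_cont g_ge1 ng cf f_le1.
  have iPhi a := mul_weight_integrable g_cont g_ge1 ng (cPhi a) (Phi_le1 a).
  have iw := mul_weight_integrable g_cont g_ge1 ng cw w_le.
  have [isum <-] := Rintegral_lincomb s f iPhi.
  rewrite -RintegralB//.
  have idiff := EFin_integrableB ifg isum.
  apply: le_trans (le_normr_Rintegral measurableT idiff) _.
  apply: le_Rintegral => //.
    by have := integrable_abse idiff; apply: eq_integrable.
  move=> x _; have -> : f x * g x - \sum_(a <- s) f a * (Phi a x * g x) =
      (f x - \sum_(a <- s) f a * phi a x) * g x.
    rewrite mulrBl mulr_suml; congr (_ - _); rewrite !big_seq.
    by apply: eq_bigr => a as_; rewrite /Phi as_ mulrA.
  rewrite normrM (ger0_norm (g_ge0 x)) ler_wpM2r//.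
  have -> : f x - \sum_(a <- s) f a * phi a x =
      f x * (1 - \sum_(a <- s) phi a x) + \sum_(a <- s) (f x - f a) * phi a x.
    under [X in _ = _ + X]eq_bigr do rewrite mulrBl.
    by rewrite sumrB -mulr_sumr; ring.
  rewrite (le_trans (ler_normD _ _))// /w addrC; apply: lerD.
    apply: (le_trans (ler_norm_sum _ _ _)).
    apply: (@le_trans _ _ (\sum_(a <- s) r * phi a x)).
      apply: ler_sum => a _; rewrite normrM (ger0_norm (phi0 a x)).
      have [rp|pr] := leP r (p (x - a)); first by rewrite phi_r// !mulr0.
      by rewrite ler_wpM2r// (le_trans (f_lip _ _))// ltW.
    by rewrite -mulr_sumr ler_piMr// ltW.
  rewrite normrM (ger0_norm (_ : 0 <= 1 - \sum_(a <- s) phi a x)) ?subr_ge0//.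
  by rewrite ler_piMl// subr_ge0.
(* Three contributions of [e / 9]: [r * g] everywhere, [N] off [K], and [g ^+ 2 / N]. *)
have wm : \int[m]_x (w x * g x) <= e / 3.
  pose Kc : set (borel X) := ~` K.
  have iKc : m.-integrable setT (EFin \o (fun x : borel X => N * \1_Kc x)).
    exact/EFin_integrableZl/integrable_indic.
  have [ig2 ig2C] := m_gC.
  have ig2N : m.-integrable setT (EFin \o (fun x => N^-1 * g x ^+ 2)).
    exact: EFin_integrableZl.
  have irg : m.-integrable setT (EFin \o (fun x => r * g x)).
    exact: EFin_integrableZl.
  have iKg := EFin_integrableD iKc ig2N.
  apply: (@le_trans _ _
    (\int[m]_x (r * g x + (N * \1_Kc x + N^-1 * g x ^+ 2)))).
    apply: le_Rintegral => //.
    - exact: (mul_weight_integrable g_cont g_ge1 m_gC cw w_le).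
    - exact: EFin_integrableD.
    - move=> x _; rewrite /w mulrDl lerD2l indicE.
      case: (boolP (x \in _)) => [_|].
        have /andP[_ h] := trunc_weight_error g_ge1 x N0.
        have h2 : Num.min (g x) N <= N by rewrite ge_min lexx orbT.
        rewrite mulr1 (@le_trans _ _ (g x))//; last by rewrite mulrC; lra.
        rewrite ler_piMl// lerBlDr lerDl.
        by apply: sumr_ge0.
      rewrite notin_setE/= => /contrapT Kx.
      rewrite phi_K// subrr mul0r mulr0 add0r.
      by rewrite mulr_ge0 ?sqr_ge0// invr_ge0 ltW.
  rewrite !RintegralD// !RintegralZl//; last exact: integrable_indic.
  rewrite Rintegral_indic// -/A.
  have : N * fine (m (~` K)) <= e / 9.
    rewrite mulrC -ler_pdivlMr// -lee_fin fineK ?fin_num_measure//.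
    exact: ltW.
  have : N^-1 * \int[m]_x (g x ^+ 2) <= e / 9.
    by rewrite mulrC (le_trans _ CN)// ler_pM2r// invr_gt0.
  by lra.
have wcv := weighted_cvg cw w_le.
have scv (t : seq X) : \sum_(a <- t)
    `| \int[mu_ i]_x (Phi a x * g x) - \int[m]_x (Phi a x * g x)|
    @[i --> F] --> (0 : R).
  elim: t => [|a t IH].
    by under eq_fun do rewrite big_nil; exact: cvg_cst.
  under eq_fun do rewrite big_cons.
  have c1 : `| \int[mu_ i]_x (Phi a x * g x) - \int[m]_x (Phi a x * g x)|
      @[i --> F] --> (0 : R).
    rewrite -(normr0 R); apply: cvg_norm.
    rewrite -(subrr (\int[m]_x (Phi a x * g x))).
    by apply: cvgB; [exact: weighted_cvg (cPhi a) (Phi_le1 a)|exact: cvg_cst].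
  by have h := cvgD c1 IH; rewrite addr0 in h; exact: h.
(* Error budget: [e / 3] for approximation under [m], [e / 3 + e / 6] under [mu_ i], and [e / 6]
   between the two combinations. *)
have e60 : 0 < e / 6 by rewrite divr_gt0.
have /cvgrPdist_le/(_ _ e60) wnear := wcv.
have /cvgrPdist_le/(_ _ e60) snear := scv s.
near=> i => f f_lip f_le1.
have mui : square_integral_le (mu_ i) g C by near: i.
have := approx _ f mui f_lip f_le1; have := approx _ f m_gC f_lip f_le1.
have : `|\int[m]_x (w x * g x) - \int[mu_ i]_x (w x * g x)| <= e / 6 by near: i.
have : `|0 - \sum_(a <- s)
      `| \int[mu_ i]_x (Phi a x * g x) - \int[m]_x (Phi a x * g x)| |
  <= e / 6 by near: i.
set Si := \sum_(a <- s) `|_|.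
have Si0 : 0 <= Si by rewrite /Si; apply: sumr_ge0.
rewrite sub0r normrN (ger0_norm Si0).
have : `| \sum_(a <- s) f a * \int[mu_ i]_x (Phi a x * g x) -
    \sum_(a <- s) f a * \int[m]_x (Phi a x * g x)| <= Si.
  rewrite -sumrB (le_trans (ler_norm_sum _ _ _))//; apply: ler_sum => a _.
  by rewrite -mulrBr normrM ler_piMl.
move: (Si) => {Si0}Si; rewrite !ler_norml.
move=> /andP[? ?] ? /andP[? ?] /andP[? ?] /andP[? ?].
by apply/andP; split; lra.
Unshelve. all: by end_near. Qed.

End weighted_convergence.

End weak_limit.

(** * Kantorovich-Rubinstein seminorms *)

Section KR_seminorms.
Context (R : realType) (X : tvsType R) (q : R) (x0 : X).
Hypothesis q_ge1 : 1 <= q.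
Implicit Types (p : X -> R) (nu : {charge set (borel X) -> \bar R}).

Let q_ge0 : 0 <= q. Proof. exact: le_trans q_ge1. Qed.

Definition KR_weight p (x : X) : R := 1 + p (x - x0) `^ q.

Definition KR_class p (f : X -> R) : Prop :=
  (forall x y, `|f x - f y| <= p (x - y)) /\ (forall x, `|f x| <= 1).

Lemma KR_weight_ge1 p x : 1 <= KR_weight p x.
Proof. by rewrite lerDl powR_ge0. Qed.

Lemma KR_weight_continuous p : continuous_seminorm p ->
  continuous (KR_weight p).
Proof.
move=> sp x; apply: cvgD; first exact: cvg_cst.
have [p0 _ _ _] := sp.
have cp : continuous (fun x => p (x - x0)) by exact: seminorm_sub_continuous.
by apply: (powR_comp_continuous q_ge1 cp) => y; exact: p0.
Qed.

(** Moments are taken at the origin while the weight is centred at [x0]; the shift is absorbed by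
    p(x - x0) <= 2 max(p(x0), p(x)), raised to the power [q]. *)
Lemma KR_weight_integrable p nu : continuous_seminorm p ->
  finite_moments q nu ->
  (Defs.total_variation nu).-integrable setT (EFin \o KR_weight p).
Proof.
move=> sp fm; have [p0 _ _ cp] := sp.
have bound x : KR_weight p x <=
    (1 + 2 `^ q * p x0 `^ q) + 2 `^ q * p x `^ q.
  rewrite /KR_weight -addrA lerD2l.
  have := seminorm_triangle x 0 x0 sp.
  rewrite subr0 sub0r (seminormN x0 sp) => tri.
  have : p (x - x0) <= 2 * Num.max (p x0) (p x).
    have : p x0 <= Num.max (p x0) (p x) by rewrite le_max lexx.
    have : p x <= Num.max (p x0) (p x) by rewrite le_max lexx orbT.
    by lra.
  have M0 : 0 <= Num.max (p x0) (p x) by rewrite le_max p0.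
  move=> /(ge0_ler_powR q_ge0); rewrite !nnegrE mulr_ge0// => /(_ (p0 _) isT).
  rewrite powRM// => /le_trans; apply; rewrite -mulrDr ler_wpM2l ?powR_ge0//.
  by rewrite /Num.max; case: ifP => _; rewrite ?lerDl ?lerDr powR_ge0.
have fin_int (n : {finite_measure set (borel X) -> \bar R}) :
    n.-integrable setT (fun x => ((p x) `^ q)%:E) ->
    n.-integrable setT (EFin \o KR_weight p).
  move=> np.
  have icst : n.-integrable setT
      (EFin \o (fun x : borel X => 1 + 2 `^ q * p x0 `^ q)).
    apply: (@bounded_integrable _ _ _ n _ `|1 + 2 `^ q * p x0 `^ q|) => [|x].
      exact: measurable_cst.
    exact: lexx.
  apply: dominated_integrable
    (EFin_integrableD icst (EFin_integrableZl (2 `^ q) np)).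
    by apply: continuous_borel_measurable; exact: KR_weight_continuous.
  move=> x; rewrite ger0_norm; last by rewrite (le_trans ler01)// KR_weight_ge1.
  exact: bound.
have h := fm p sp; apply: integrable_total_variation; apply: fin_int.
  exact: integrable_pos_part.
exact: integrable_neg_part.
Qed.

Lemma KR_class_measurable p f : continuous_seminorm p -> KR_class p f ->
  measurable_fun [set: borel X] f.
Proof.
move=> sp [/(seminorm_lipschitz_continuous sp) cf _].
exact: continuous_borel_measurable.
Qed.

Lemma KR_class0 p : continuous_seminorm p -> KR_class p (cst 0).
Proof.
move=> [p0 _ _ _]; split=> [x y|x]; last by rewrite normr0.
by rewrite subrr normr0.
Qed.

Section difference.
Variables (p : X -> R) (nu1 nu2 : {charge set (borel X) -> \bar R}).
Hypotheses (sp : continuous_seminorm p).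
Hypotheses (fm1 : finite_moments q nu1) (fm2 : finite_moments q nu2).

Let weighted_bound nu f : finite_moments q nu -> KR_class p f ->
  `|charge_integral nu (fun x => f x * KR_weight p x)| <=
    \int[pos_part nu]_x KR_weight p x + \int[neg_part nu]_x KR_weight p x.
Proof.
move=> fm cf; have w0 x : 0 <= KR_weight p x.
  by rewrite (le_trans ler01)// KR_weight_ge1.
apply: le_charge_integral; first exact: KR_weight_integrable.
- apply: measurable_funM; first exact: KR_class_measurable cf.
  by apply: continuous_borel_measurable; exact: KR_weight_continuous.
- by move=> x; rewrite normrM (ger0_norm (w0 x)) ler_piMl//; case: cf.
Qed.

Lemma KR_charge_integral f : KR_class p f ->
  charge_integral
    (charge_density (KR_weight p : borel X -> R) (csub nu1 nu2)) f =
  charge_integral nu1 (fun x => f x * KR_weight p x) -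
  charge_integral nu2 (fun x => f x * KR_weight p x).
Proof.
move=> cf; have w0 x : 0 <= KR_weight p x.
  by rewrite (le_trans ler01)// KR_weight_ge1.
have i1 := KR_weight_integrable sp fm1; have i2 := KR_weight_integrable sp fm2.
have mf := KR_class_measurable sp cf.
have mfw : measurable_fun [set: borel X] (fun x => f x * KR_weight p x).
  apply: measurable_funM => //.
  by apply: continuous_borel_measurable; exact: KR_weight_continuous.
have fw x : `|f x * KR_weight p x| <= KR_weight p x.
  by rewrite normrM (ger0_norm (w0 x)) ler_piMl//; case: cf.
have i12 := csub_integrable i1 i2.
rewrite (@charge_integral_density _ (borel X) _ _ (KR_weight p) f 1)//;
  last exact: cf.2.
by apply: charge_integral_csub; apply: dominated_integrable mfw fw _.
Qed.

Lemma KR_class_le_K_seminorm f : KR_class p f ->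
  charge_integral nu1 (fun x => f x * KR_weight p x) -
  charge_integral nu2 (fun x => f x * KR_weight p x) <=
  K_seminorm q x0 p (csub nu1 nu2).
Proof.
move=> cf; rewrite -KR_charge_integral//; apply: ub_le_sup; last by exists f.
pose B nu := \int[pos_part nu]_x KR_weight p x +
  \int[neg_part nu]_x KR_weight p x.
(* A real [sup] dominates its elements only when the set is bounded above; the weighted Jordan
   masses provide the bound. *)
exists (B nu1 + B nu2).
move=> _ [h ch <-]; rewrite [leLHS]KR_charge_integral//.
rewrite (le_trans (ler_norm _))//.
by rewrite (le_trans (ler_normB _ _))// lerD// weighted_bound.
Qed.

Lemma K_seminorm_le (e : R) :
  (forall f, KR_class p f ->
    charge_integral nu1 (fun x => f x * KR_weight p x) -
    charge_integral nu2 (fun x => f x * KR_weight p x) <= e) ->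
  K_seminorm q x0 p (csub nu1 nu2) <= e.
Proof.
move=> le_e; apply: ge_sup.
  exists (charge_integral
    (charge_density (KR_weight p : borel X -> R) (csub nu1 nu2)) (cst 0)).
  by exists (cst 0) => //; exact: KR_class0.
by move=> _ [f cf <-]; rewrite [leLHS]KR_charge_integral//; exact: le_e.
Qed.

End difference.

(** Neighbourhoods contain finite intersections of balls whose centres [nu] need not be [m]. Adding
    the uniform error to the seminorm of [m - nu] keeps [m_ i] in each ball, because membership of
    [m] leaves a positive slack. *)
Lemma tauK_cvg (I : Type) (F : set_system I) (m_ : I -> tauK q x0)
    (m : tauK q x0) : Filter F ->
  (forall p, continuous_seminorm p -> forall e : R, 0 < e ->
    \forall i \near F, forall f, KR_class p f ->
      `|charge_integral (Mrq_charge (m_ i)) (fun x => f x * KR_weight p x) -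
        charge_integral (Mrq_charge m) (fun x => f x * KR_weight p x)| <= e) ->
  m_ i @[i --> F] --> m.
Proof.
move=> FF unif U; rewrite nbhsE => -[V [[D sD <-] [W DW Wm]] VU].
have [A sA WE] : exists2 A : {fset (set (tauK q x0))},
    {subset A <= tauK_subbase (x0 := x0)} & \bigcap_(S in [set` A]) S = W.
  exact: sD _ DW.
have near_A : F (\bigcap_(S in [set` A]) [set i | S (m_ i)]).
  apply: filter_bigI => S SA.
  have /sA/set_mem[p [nu [e [sp e0 SE]]]] := SA.
  have Sm : S m by move: Wm; rewrite -WE; apply.
  move: Sm; rewrite SE /= => K_lt.
  pose K := K_seminorm q x0 p (csub (Mrq_charge m) (Mrq_charge nu)).
  have d0 : 0 < (e - K) / 2 by rewrite divr_gt0// subr_gt0.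
  apply: filterS (unif p sp _ d0) => i near_i.
  apply: (@le_lt_trans _ _ ((e - K) / 2 + K)); last first.
    by move: K_lt; rewrite -/K; lra.
  apply: K_seminorm_le => //; [exact: Mrq_moments|exact: Mrq_moments|].
  move=> f cf; have := near_i f cf.
  have := KR_class_le_K_seminorm sp (Mrq_moments m) (Mrq_moments nu) cf.
  by rewrite -/K ler_norml => h /andP[_]; lra.
apply: (@filterS _ F FF _ [set i | U (m_ i)] _ near_A) => i iA.
have Wi : W (m_ i) by rewrite -WE => S; exact: iA.
by apply: VU; exists W.
Qed.

End KR_seminorms.

(** Points of [tauK] carry proofs of the Radon property and of finite moments, so the existential
    form also asserts that all these measures belong to the space. *)
Theorem corollary4p2 (R : realType) (X : tvsType R)
    (X_hausdorff : hausdorff_space X)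
    (I : Type) (le : I -> I -> Prop) (le_directed : directed_preorder le)
    (mu_ : I -> probability (borel X) R)
    (mu : {charge set (borel X) -> \bar R})
    (mu_log_concave : forall i, log_concave (mu_ i))
    (mu_radon : signed_radon mu)
    (mu_cvg : weak_cvg (tails le)
      (fun i => charge_of_finite_measure (mu_ i)) mu)
    (q : R) (q_ge1 : 1 <= q) (x0 : X) :
  exists (m_ : I -> tauK q x0) (m : tauK q x0),
    [/\ forall i, Mrq_charge (m_ i) = charge_of_finite_measure (mu_ i),
        Mrq_charge m = mu
      & m_ i @[i --> tails le] --> m].
Proof.
have FF := tails_proper_filter le_directed.
have q_ge0 : 0 <= q by exact: le_trans q_ge1.
have mu_i_integral i f : (mu_ i).-integrable setT (EFin \o f) ->
    charge_integral (charge_of_finite_measure (mu_ i)) f = \int[mu_ i]_x f x.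
  by apply: charge_integral_measure.
have mu_cvg' (f : X -> R) : continuous f ->
    (exists M : R, forall x, `|f x| <= M) ->
    \int[mu_ i]_x f x @[i --> tails le] --> charge_integral mu f.
  move=> cf [M fM]; have := mu_cvg f cf (ex_intro _ M fM).
  under eq_fun => i do
    rewrite mu_i_integral ?(continuous_bounded_integrable (mu_ i) cf fM)//.
  exact.
(* The signed limit integrates nonnegative test functions to nonnegative values, hence is a measure;
   its positive part [m] then stands for it. *)
have neg0 : neg_part mu setT = 0%E.
  apply: signed_radon_neg_part0 => // f cf f01.
  have f_le1 x : `|f x| <= 1 by have /andP[? ?] := f01 x; rewrite ger0_norm.
  have cv := mu_cvg' f cf (ex_intro _ 1 f_le1).
  rewrite -(cvg_lim _ cv)//; apply: limr_ge; first exact: cvgP cv.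
  apply: nearW => i; apply: Rintegral_ge0 => x _.
  by have /andP[] := f01 x.
pose m := pos_part mu.
have muE A : measurable A -> mu A = m A.
  move=> mA; rewrite pos_neg_part// (_ : neg_part mu A = 0%E) ?sube0//.
  apply/eqP; rewrite eq_le measure_ge0 andbT -neg0.
  by apply: le_measure; [exact: mem_set|exact/mem_set/measurableT|].
have mu_integral f : m.-integrable setT (EFin \o f) ->
    charge_integral mu f = \int[m]_x f x by exact: charge_integral_measure.
have m_cvg (f : X -> R) : continuous f ->
    (exists M : R, forall x, `|f x| <= M) ->
    \int[mu_ i]_x f x @[i --> tails le] --> \int[m]_x f x.
  move=> cf [M fM]; rewrite -mu_integral; last first.
    exact: (continuous_bounded_integrable m cf fM).
  by apply: mu_cvg' => //; exists M.
have m_radon : radon m.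
  move=> B mB e e0; have [K KB BK] := mu_radon B mB e e0.
  by exists K => //; apply: le_lt_trans BK; exact: leeDl.
have mu_i_radon i : signed_radon (charge_of_finite_measure (mu_ i)).
  have [mu_i_radon _] := mu_log_concave i.
  move=> B mB e e0; have [K [cK KB] BK] := mu_i_radon B mB e e0.
  exists K => //; apply: le_lt_trans BK; apply: le_total_variation => //.
  apply: measurableD => //; apply: closed_borel_measurable.
  exact: compact_closed.
(* Centre 0 turns the shifted seminorm into [p] itself, the form that [finite_moments] asks for. *)
have mu_i_moments i : finite_moments q (charge_of_finite_measure (mu_ i)).
  move=> p sp; have := log_concave_weight_integrable X_hausdorff
    mu_log_concave 0 sp i q_ge0.
  under eq_fun do rewrite subr0.
  by apply: le_measure_integrable => A mA; exact: le_total_variation.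
have mu_moments : finite_moments q mu.
  move=> p sp; have [C [_ m_C]] := weight_square_integral X_hausdorff m_cvg
    mu_log_concave 0 sp q_ge0.
  have cw := @KR_weight_continuous _ _ _ 0 q_ge1 _ sp.
  have w1 := @KR_weight_ge1 _ _ q 0 p.
  have mp := weight_integrable cw w1 m_C.
  apply: (@le_measure_integrable _ _ _ _ m).
    by move=> A mA; exact: le_total_variation.
  apply: (@dominated_integrable _ _ _ m (fun x => p x `^ q)
    (KR_weight q 0 p)) => //.
    apply: continuous_borel_measurable.
    by have [p0 _ _ cp] := sp; exact: powR_comp_continuous.
  by move=> x; rewrite ger0_norm ?powR_ge0// /KR_weight subr0 lerDr.
exists (fun i : I => MkMrq (mu_i_radon i) (mu_i_moments i) : tauK q x0).
exists (MkMrq mu_radon mu_moments : tauK q x0); split => //.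
apply: tauK_cvg => // p sp e e0 /=.
(* The second moment bound is taken again, now for the weight centred at [x0] that occurs in the
   seminorms. *)
have [C [mu_C m_C]] := weight_square_integral X_hausdorff m_cvg mu_log_concave
  x0 sp q_ge0.
have cw := @KR_weight_continuous _ _ _ x0 q_ge1 _ sp.
have w1 := @KR_weight_ge1 _ _ q x0 p.
have unif := weighted_cvg_uniform X_hausdorff m_cvg cw w1 mu_C m_C sp m_radon
  e0.
apply: filterS2 mu_C (unif FF) => i mui_C near_i f [f_lip f_le1].
have cf := seminorm_lipschitz_continuous sp f_lip.
have ii := mul_weight_integrable cw w1 mui_C cf f_le1.
have im := mul_weight_integrable cw w1 m_C cf f_le1.
rewrite (mu_i_integral i _ ii) (mu_integral _ im).
exact: near_i.
Qed.
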